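(* Fix $\alpha\in(0,1)$ and let $\rho=\mathrm{ES}^\alpha$ on $L=L^1$. Then for every $\nu\ge0$ the set $\Pi^{\mathrm{ES}^\alpha}_\nu$ of $\mathrm{ES}^\alpha$-optimal portfolios is nonempty, compact and convex. Moreover: (a) the market does not admit strong $\mathrm{ES}^\alpha$-arbitrage if and only if there exists $Z\in\mathcal{M}$ with $\|Z\|_\infty\le 1/\alpha$; (b) the market does not admit $\mathrm{ES}^\alpha$-arbitrage if and only if there exists $Z\in\mathcal{P}$ with $\|Z\|_\infty<1/\alpha$.
   Context: Let $(\Omega,\mathcal{F},\mathbb{P})$ be a probability space and a market: riskless asset $S^0_0=1$, $S^0_1=1+r$, $r>-1$; risky assets $S^1,\dots,S^d$ with constants $S^i_0>0$ and real-valued $\mathcal{F}$-measurable $S^i_1$; returns $R^i:=(S^i_1-S^i_0)/S^i_0$. Standing assumptions: nonredundancy (if $\theta\in\mathbb{R}^{1+d}$ with $\sum_{i=0}^d\theta^iS^i_t=0$ a.s. for $t\in\{0,1\}$ then $\theta=0$), $R^i\in L^1$, $\mathbb{E}[R^i]\ne r$ for some $i$. Excess return of $\pi\in\mathbb{R}^d$: $X_\pi:=\pi\cdot(R-r\mathbf{1})$; $\Pi_\nu:=\{\pi:\mathbb{E}[X_\pi]=\nu\}$. For $X\in L^1$: $\mathrm{VaR}^u(X):=\inf\{m\in\mathbb{R}:\mathbb{P}[m+X<0]\le u\}$ and $\mathrm{ES}^\alpha(X):=\frac1\alpha\int_0^\alpha\mathrm{VaR}^u(X)\,du$. For a risk measure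 $\rho$: $\Pi^\rho_\nu$ is the set of $\pi\in\Pi_\nu$ with $\rho(X_\pi)<\infty$ and $\rho(X_\pi)\le\rho(X_{\pi'})$ for all $\pi'\in\Pi_\nu$. $\pi$ is $\rho$-efficient if $\mathbb{E}[X_\pi]\ge0$ and no $\pi'$ has $\mathbb{E}[X_{\pi'}]\ge\mathbb{E}[X_\pi]$, $\rho(X_{\pi'})\le\rho(X_\pi)$ with one inequality strict; $\rho$-arbitrage means no $\rho$-efficient portfolio exists; strong $\rho$-arbitrage means for every $\pi$ there is $\pi'$ with $\mathbb{E}[X_{\pi'}]>\mathbb{E}[X_\pi]$ and $\rho(X_{\pi'})<\rho(X_\pi)$. $\mathcal{D}:=\{Z\in L^1:Z\ge0,\mathbb{E}[Z]=1\}$, $\mathcal{M}:=\{Z\in\mathcal{D}:\mathbb{E}[Z(R^i-r)]=0\ \forall i\}$, $\mathcal{P}:=\{Z\in\mathcal{M}:Z>0\text{ a.s.}\}$. *)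

(* Defs.v *)
From HB Require Import structures.
From mathcomp Require Import all_boot all_order all_algebra.
From mathcomp Require Import all_classical all_reals all_analysis.
Set Implicit Arguments. Unset Strict Implicit. Unset Printing Implicit Defensive.
Import Order.TTheory GRing.Theory Num.Theory.
Import numFieldNormedType.Exports.
Local Open Scope classical_set_scope.
Local Open Scope ring_scope.

Section market.
Context {d : measure_display} {T : measurableType d} {R : realType}.
Variable P : probability T R.

(* expectation of a real random variable (meaningful for integrable X) *)
Definition Exp (X : T -> R) : R := fine (\int[P]_w (X w)%:E)%E.

Definition integrableP (X : T -> R) : Prop :=
  measurable_fun [set: T] X /\ P.-integrable [set: T] (EFin \o X).

Definition VaR (u : R) (X : T -> R) : \bar R :=
  ereal_inf [set m%:E | m in [set m : R | (P [set w | (m + X w < 0)%R] <= u%:E)%E]].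

Definition ES (alpha : R) (X : T -> R) : \bar R :=
  ((alpha^-1)%:E * \int[(@lebesgue_measure R)]_(u in [set` `]0%R, alpha[%R]) VaR u X)%E.

(* market data: n risky assets, riskless rate r, prices S0 (time 0), S1 (time 1) *)
Variables (n : nat) (r : R) (S0 : 'I_n -> R) (S1 : 'I_n -> T -> R).

Definition Ret (i : 'I_n) (w : T) : R := (S1 i w - S0 i) / S0 i.

Definition Xp (pi : 'rV[R]_n) (w : T) : R := \sum_(i < n) pi ord0 i * (Ret i w - r).

Definition Pi_nu (nu : R) : set 'rV[R]_n := [set pi | Exp (Xp pi) = nu].

Definition Pi_opt (rho : (T -> R) -> \bar R) (nu : R) : set 'rV[R]_n :=
  [set pi | Pi_nu nu pi /\ (rho (Xp pi) < +oo)%E /\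
            forall pi', Pi_nu nu pi' -> (rho (Xp pi) <= rho (Xp pi'))%E].

Definition efficient (rho : (T -> R) -> \bar R) (pi : 'rV[R]_n) : Prop :=
  0 <= Exp (Xp pi) /\
  ~ exists pi', Exp (Xp pi') >= Exp (Xp pi) /\ (rho (Xp pi') <= rho (Xp pi))%E /\
                (Exp (Xp pi') > Exp (Xp pi) \/ (rho (Xp pi') < rho (Xp pi))%E).

Definition rho_arbitrage (rho : (T -> R) -> \bar R) : Prop :=
  ~ exists pi, efficient rho pi.

Definition strong_rho_arbitrage (rho : (T -> R) -> \bar R) : Prop :=
  forall pi, exists pi', Exp (Xp pi') > Exp (Xp pi) /\ (rho (Xp pi') < rho (Xp pi))%E.

Definition in_D (Z : T -> R) : Prop :=
  integrableP Z /\ {ae P, forall w, 0 <= Z w} /\ Exp Z = 1.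

Definition in_M (Z : T -> R) : Prop :=
  in_D Z /\ forall i : 'I_n,
    integrableP (fun w => Z w * (Ret i w - r)) /\ Exp (fun w => Z w * (Ret i w - r)) = 0.

Definition in_Pset (Z : T -> R) : Prop := in_M Z /\ {ae P, forall w, 0 < Z w}.

Definition Linf_norm (Z : T -> R) : \bar R := Lnorm P +oo%E (EFin \o Z).

Definition nonredundant : Prop :=
  forall (th0 : R) (th : 'rV[R]_n),
    th0 + \sum_(i < n) th ord0 i * S0 i = 0 ->
    {ae P, forall w, th0 * (1 + r) + \sum_(i < n) th ord0 i * S1 i w = 0} ->
    th0 = 0 /\ th = 0.

Definition standing_assumptions : Prop :=
  -1 < r /\ (forall i, 0 < S0 i) /\ (forall i, measurable_fun [set: T] (S1 i)) /\
  nonredundant /\ (forall i, integrableP (Ret i)) /\ (exists i, Exp (Ret i) <> r).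

End market.

Definition convex_rV (R : realType) (n : nat) (A : set 'rV[R]_n) : Prop :=
  forall x y (t : R), A x -> A y -> 0 <= t <= 1 -> A (t *: x + (1 - t) *: y).

(* Main.v *)
Require Import Defs.
From HB Require Import structures.
From mathcomp Require Import all_boot all_order all_algebra.
From mathcomp Require Import all_classical all_reals all_analysis.
From mathcomp Require Import measurable_realfun random_variable ess_sup_inf.
From mathcomp Require Import ring lra.
Import Order.TTheory GRing.Theory Num.Theory.
Import numFieldNormedType.Exports.
Local Open Scope classical_set_scope.
Local Open Scope ring_scope.

(**
  Expected shortfall is the minimum over [m] of the Rockafellar-Uryasev function
  [m + E(- m - X)^+ / alpha], so [f pi := ES(X_pi)] is finite, sublinear and Lipschitz on
  the space of portfolios, with [f pi >= - E X_pi] and equality only for constant [X_pi].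
  Nonredundancy then gives [f > 0] on [Pi_0 \ 0], hence coercivity of [f] on every [Pi_nu],
  and the optimal set is a compact convex sublevel set.

  Absence of strong arbitrage amounts to [f >= 0], absence of arbitrage to [f > 0] off the
  origin.  Densities [Z <= c <= 1 / alpha] bound [f] below by [- E(Z X_pi) = 0], strictly if
  [0 < Z] and [c < 1 / alpha].  Conversely, the inequalities [f >= 0], respectively
  [f pi >= e |pi|], are exactly the necessary conditions for a finite moment problem for
  functions with values in [0, 1], and those conditions are sufficient.
*)

Set Implicit Arguments.
Unset Strict Implicit.
Unset Printing Implicit Defensive.

Local Notation L1 := Defs.integrableP.

(** * Integrable random variables and their real-valued expectation *)

Section expectation.
Context {d : measure_display} {T : measurableType d} {R : realType}.
Variable P : probability T R.
Implicit Types (X Y Z : T -> R) (c : R).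

Lemma L1_cst c : L1 P (fun=> c).
Proof.
split; first exact: measurable_cst.
apply/integrableP; split; first by apply/measurable_EFinP; exact: measurable_cst.
rewrite [ltLHS](_ : _ = \int[P]_(w in setT) (cst (`|c|)%:E) w)%E //.
rewrite integral_cst// [X in (_ * X)%E](_ : _ = 1%E) ?mule1 ?ltry//.
exact: probability_setT.
Qed.

Lemma L1_le X Y : measurable_fun setT X -> L1 P Y ->
  (forall w, `|X w| <= Y w) -> L1 P X.
Proof.
move=> mX [mY iY] XY; split=> //.
apply: (le_integrable _ _ _ iY) => //; first exact/measurable_EFinP.
by move=> w _ /=; rewrite lee_fin (le_trans (XY w))// ler_norm.
Qed.

Lemma L1D X Y : L1 P X -> L1 P Y ->
  L1 P (fun w => X w + Y w).
Proof.
move=> [mX iX] [mY iY]; split; first exact: measurable_funD.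
exact: (integrableD _ iX iY).
Qed.

Lemma L1Z c X : L1 P X -> L1 P (fun w => c * X w).
Proof.
move=> [mX iX]; split; first exact: measurable_funM.
exact: (integrableZl _ c iX).
Qed.

Lemma L1N X : L1 P X -> L1 P (fun w => - X w).
Proof.
move=> iX; rewrite (_ : (fun _ => _) = fun w => -1 * X w); first exact: L1Z.
by apply/funext => w; rewrite mulN1r.
Qed.

Lemma L1B X Y : L1 P X -> L1 P Y ->
  L1 P (fun w => X w - Y w).
Proof. by move=> iX iY; apply: L1D => //; exact: L1N. Qed.

Lemma L1_sum (I : Type) (s : seq I) (X_ : I -> T -> R) :
  (forall i, L1 P (X_ i)) -> L1 P (fun w => \sum_(i <- s) X_ i w).
Proof.
move=> iX; elim: s => [|i s IHs].
  by under eq_fun do rewrite big_nil; exact: L1_cst.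
by under eq_fun do rewrite big_cons; exact: L1D.
Qed.

Lemma L1_norm X : L1 P X -> L1 P (fun w => `|X w|).
Proof.
move=> [mX iX]; split; first exact: measurableT_comp.
exact: (integrable_norm iX).
Qed.

Lemma L1_bndM c X Z : measurable_fun setT Z -> (forall w, `|Z w| <= c) ->
  L1 P X -> L1 P (fun w => Z w * X w).
Proof.
move=> mZ Zc iX; have [mX _] := iX.
apply: (@L1_le _ (fun w => c * `|X w|)).
- exact: measurable_funM.
- by apply: L1Z; exact: L1_norm.
- by move=> w; rewrite normrM ler_wpM2r.
Qed.

Lemma L1_pos X : L1 P X -> L1 P (fun w => Num.max 0 (X w)).
Proof.
move=> iX; have [mX _] := iX.
apply: L1_le (L1_norm iX) _; first exact: measurable_maxr.
by move=> w; have [] := leP 0 (X w); rewrite ?normr0.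
Qed.

Lemma L1_bnd c Z : measurable_fun setT Z -> (forall w, `|Z w| <= c) ->
  L1 P Z.
Proof. by move=> mZ Zc; exact: L1_le (L1_cst c) _. Qed.

Lemma Exp_cst c : Exp P (fun=> c) = c.
Proof.
rewrite /Exp integral_cst// [X in (_ * X)%E](_ : _ = 1%E) ?mule1//.
exact: probability_setT.
Qed.

Lemma integral_Exp X : L1 P X -> (\int[P]_w (X w)%:E)%E = (Exp P X)%:E.
Proof. by move=> [mX iX]; rewrite /Exp fineK//; exact: integrable_fin_num. Qed.

Lemma ExpD X Y : L1 P X -> L1 P Y ->
  Exp P (fun w => X w + Y w) = Exp P X + Exp P Y.
Proof.
move=> iX iY; apply: EFin_inj; rewrite EFinD -!integral_Exp//.
  by rewrite -(integralD_EFin _ iX.2 iY.2).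
exact: L1D.
Qed.

Lemma ExpZ c X : L1 P X -> Exp P (fun w => c * X w) = c * Exp P X.
Proof.
move=> iX; apply: EFin_inj; rewrite EFinM -!integral_Exp//.
  by rewrite -(integralZl _ iX.2).
exact: L1Z.
Qed.

Lemma ExpN X : L1 P X -> Exp P (fun w => - X w) = - Exp P X.
Proof.
move=> iX; rewrite -mulN1r -ExpZ//; congr Exp.
by apply/funext => w; rewrite mulN1r.
Qed.

Lemma ExpB X Y : L1 P X -> L1 P Y ->
  Exp P (fun w => X w - Y w) = Exp P X - Exp P Y.
Proof. by move=> iX iY; rewrite ExpD ?ExpN//; exact: L1N. Qed.

Lemma Exp_sum (I : Type) (s : seq I) (X_ : I -> T -> R) :
  (forall i, L1 P (X_ i)) ->
  Exp P (fun w => \sum_(i <- s) X_ i w) = \sum_(i <- s) Exp P (X_ i).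
Proof.
move=> iX; elim: s => [|i s IHs].
  by under eq_fun do rewrite big_nil; rewrite big_nil Exp_cst.
under eq_fun do rewrite big_cons; rewrite big_cons ExpD ?IHs//.
exact: L1_sum.
Qed.

Lemma Exp_ge0 X : (forall w, 0 <= X w) -> 0 <= Exp P X.
Proof. by move=> X0; rewrite fine_ge0// integral_ge0// => w _; rewrite lee_fin. Qed.

Lemma le_Exp X Y : L1 P X -> L1 P Y -> (forall w, X w <= Y w) ->
  Exp P X <= Exp P Y.
Proof.
move=> iX iY XY; rewrite -subr_ge0 -ExpB//; apply: Exp_ge0 => w.
by rewrite subr_ge0.
Qed.

Lemma ae_eq_Exp X Y : measurable_fun setT X -> measurable_fun setT Y ->
  {ae P, forall w, X w = Y w} -> Exp P X = Exp P Y.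
Proof.
move=> mX mY XY; congr fine; apply: ae_eq_integral => //;
  try exact/measurable_EFinP.
by apply: filterS XY => w -> _.
Qed.

Lemma Exp_eq0_ae X : L1 P X -> {ae P, forall w, 0 <= X w} -> Exp P X = 0 ->
  {ae P, forall w, X w = 0}.
Proof.
move=> iX X0 EX; have [mX _] := iX.
have mE : measurable_fun setT (EFin \o X) by exact/measurable_EFinP.
have [+ _] := ae_eq_integral_abs P measurableT mE.
have -> : (\int[P]_(x in setT) `|(EFin \o X) x|)%E = (\int[P]_x (X x)%:E)%E.
  apply: ae_eq_integral => //; first exact: measurableT_comp.
  by apply: filterS X0 => w w0 _ /=; rewrite ger0_norm.
rewrite integral_Exp// EX => /(_ erefl); apply: filterS => w /(_ I) /=.
by case.
Qed.

Lemma cvg_Exp (f_ : nat -> T -> R) (f g : T -> R) : (forall m, measurable_fun setT (f_ m)) ->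
  measurable_fun setT f ->
  (forall w, f_ ^~ w @ \oo --> f w) -> L1 P g ->
  (forall m w, `|f_ m w| <= g w) -> Exp P (f_ m) @[m --> \oo] --> Exp P f.
Proof.
move=> mf_ mf cf ig fg.
have iF m : L1 P (f_ m) by exact: L1_le ig _.
have := @dominated_convergence _ _ _ P setT measurableT (fun m w => (f_ m w)%:E)
  (EFin \o f) (EFin \o g).
case=> //.
- by move=> m; exact/measurable_EFinP.
- exact/measurable_EFinP.
- by apply/aeW => w _; apply: cvg_EFin (cf w); exact: nearW.
- exact: ig.2.
- by apply/aeW => w m _ /=; rewrite lee_fin.
move=> iff _ cE; rewrite /Exp.
apply: fine_cvg; rewrite fineK//; last by rewrite integral_Exp.
Qed.

End expectation.

(** * Linear forms, coercivity and minimisation on finite-dimensional row vectors *)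

Section row_vectors.
Context {R : realType} {k : nat}.
Implicit Types (x y : 'rV[R]_k) (a b : 'I_k -> R) (t : R).

Definition dotv x a : R := \sum_(i < k) x ord0 i * a i.

Lemma dotvDl x y a : dotv (x + y) a = dotv x a + dotv y a.
Proof. by rewrite -big_split; apply: eq_bigr => i _; rewrite mxE mulrDl. Qed.

Lemma dotvZl t x a : dotv (t *: x) a = t * dotv x a.
Proof. by rewrite /dotv mulr_sumr; apply: eq_bigr => i _; rewrite mxE mulrA. Qed.

Lemma dotvNl x a : dotv (- x) a = - dotv x a.
Proof. by rewrite -scaleN1r dotvZl mulN1r. Qed.

Lemma dotvBl x y a : dotv (x - y) a = dotv x a - dotv y a.
Proof. by rewrite dotvDl dotvNl. Qed.

Lemma dotv0l a : dotv 0 a = 0.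
Proof. by rewrite /dotv big1// => i _; rewrite mxE mul0r. Qed.

Lemma dotvBr x a b : dotv x (fun i => a i - b i) = dotv x a - dotv x b.
Proof. by rewrite -sumrB; apply: eq_bigr => i _; rewrite mulrBr. Qed.

Lemma dotvZr t x a : dotv x (fun i => t * a i) = t * dotv x a.
Proof. by rewrite /dotv mulr_sumr; apply: eq_bigr => i _; rewrite mulrCA. Qed.

Lemma dotv_delta i a : dotv (delta_mx ord0 i) a = a i.
Proof.
rewrite /dotv (bigD1 i)//= mxE !eqxx mul1r big1 ?addr0// => j ji.
by rewrite mxE eqxx (negbTE ji) mul0r.
Qed.

Lemma normr_coord x i : `|x ord0 i| <= `|x|.
Proof.
rewrite [leRHS]mx_normrE (le_trans _ (le_bigmax _ _ (ord0, i)))//.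
Qed.

Lemma normr_dotv x a : `|dotv x a| <= `|x| * \sum_i `|a i|.
Proof.
rewrite mulr_sumr; apply: le_trans (ler_norm_sum _ _ _) _.
by apply: ler_sum => i _; rewrite normrM ler_wpM2r// normr_coord.
Qed.

Lemma lipschitz_continuous_rV (h : 'rV[R]_k -> R) (K : R) :
  (forall x y, `|h x - h y| <= K * `|x - y|) -> continuous h.
Proof.
move=> hK x; apply/(@cvgrPdist_lt _ _ _ (nbhs x) (nbhs_filter x)) => e e0.
(* No sign is assumed on [K], so a positive Lipschitz constant replaces it. *)
have K0 : 0 < `|K| + 1 by rewrite ltr_wpDl.
have eK : 0 < e / (`|K| + 1) by rewrite divr_gt0.
have := nbhsx_ballx x _ eK; rewrite mx_norm_ball; apply: filterS => y xy.
apply: le_lt_trans (hK x y) _.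
apply: (@le_lt_trans _ _ ((`|K| + 1) * `|x - y|)).
  by rewrite ler_wpM2r// (le_trans (ler_norm K))// lerDl.
by rewrite mulrC -ltr_pdivlMr.
Qed.

(** The constant [e] is the minimum of [h] over the unit vectors of the cone [C], a compact set on
    which [h] is positive; homogeneity carries the bound to all of [C]. *)
Lemma pos_homogeneous_coercive (C : set 'rV[R]_k) (h : 'rV[R]_k -> R) :
  closed C -> (forall t x, 0 <= t -> C x -> C (t *: x)) -> continuous h ->
  (forall t x, 0 <= t -> h (t *: x) = t * h x) ->
  (forall x, C x -> x != 0 -> 0 < h x) ->
  exists2 e, 0 < e & forall x, C x -> e * `|x| <= h x.
Proof.
move=> cC CZ ch hZ hpos.
have h0 : h 0 = 0 by rewrite -[X in h X](scale0r 0) hZ// mul0r.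
pose S := C `&` [set x | `|x| = 1].
have CS x : C x -> x != 0 -> S (`|x|^-1 *: x).
  move=> Cx x0; split; first by apply: CZ; rewrite ?invr_ge0.
  by rewrite /= normrZ normfV normr_id mulVf// normr_eq0.
have cS : compact S.
  apply: bounded_closed_compact.
    exists 1; split => // M M1 x [_ /= ->]; exact: ltW.
  apply: closedI => //.
  rewrite (_ : [set x | _] = (fun x => `|x|) @^-1` [set 1])//.
  apply: preimage_closed; last exact: closed_eq.
  by move=> x _; exact: norm_continuous.
(* Without unit vectors the cone is contained in the origin, where any [e] will do. *)
have [S0|/set0P S0] := eqVneq S set0.
  exists 1 => // x Cx; have [->|/(CS _ Cx)] := eqVneq x 0; last by rewrite S0.
  by rewrite normr0 mulr0 h0.
have [c cSc cmin] := EVT_min_rV S0 cS (continuous_subspaceT ch).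
move: cSc; rewrite inE => -[Cc c1].
exists (h c).
  by apply: hpos => //; rewrite -normr_eq0 c1 oner_neq0.
move=> x Cx; have [->|x0] := eqVneq x 0; first by rewrite normr0 mulr0 h0.
have := cmin (`|x|^-1 *: x); rewrite inE => /(_ (CS _ Cx x0)).
by rewrite hZ ?invr_ge0// [leRHS]mulrC ler_pdivlMr// normr_gt0.
Qed.

Lemma coercive_sublevel_compact (A : set 'rV[R]_k) (h : 'rV[R]_k -> R) (e c v : R) :
  closed A -> continuous h -> 0 < e ->
  (forall x, A x -> e * `|x| - c <= h x) ->
  compact (A `&` [set x | h x <= v]).
Proof.
move=> cA ch e0 hcoer.
apply: bounded_closed_compact.
  exists ((v + c) / e); split; first exact: num_real.
  move=> M MM x [Ax /= hx]; apply: le_trans (ltW MM).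
  rewrite ler_pdivlMr// mulrC -lerBlDr; exact: le_trans (hcoer _ Ax) hx.
apply: closedI => //.
rewrite (_ : [set x | _] = h @^-1` [set y | y <= v])//.
by apply: preimage_closed; [move=> x _; exact: ch|exact: closed_le].
Qed.

(** Only points of the sublevel set through one fixed point of [A] compete for the minimum, and that
    set is compact. *)
Lemma coercive_min (A : set 'rV[R]_k) (h : 'rV[R]_k -> R) (e c : R) :
  A !=set0 -> closed A -> continuous h -> 0 < e ->
  (forall x, A x -> e * `|x| - c <= h x) ->
  exists2 x, A x & forall y, A y -> h x <= h y.
Proof.
move=> [x0 Ax0] cA ch e0 hcoer.
pose B := A `&` [set x | h x <= h x0].
have cB : compact B := coercive_sublevel_compact (v := h x0) cA ch e0 hcoer.
have [z zB zmin] := EVT_min_rV (ex_intro _ x0 (conj Ax0 (lexx _)) : B !=set0)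
  cB (continuous_subspaceT ch).
move: zB; rewrite inE => -[Az hz]; exists z => // y Ay.
have [hy|/ltW hy] := leP (h y) (h x0); last exact: le_trans hz hy.
by apply: zmin; rewrite inE.
Qed.

End row_vectors.

(** * The clamp to [0, 1], the positive part and its smoothing, all 1-Lipschitz *)

Section clamp.
Context {R : realType}.
Implicit Types u v c : R.

Definition clamp01 u : R := Num.max 0 (Num.min u 1).

(* The Moreau-Yosida regularisation of the positive part, with derivative [clamp01]. *)
Definition smooth_pos u : R := clamp01 u * u - clamp01 u ^+ 2 / 2.

Lemma clamp01_ge0 u : 0 <= clamp01 u.
Proof. by rewrite le_max lexx. Qed.

Lemma clamp01_le1 u : clamp01 u <= 1.
Proof. by rewrite ge_max ler01 ge_min lexx orbT. Qed.

(** The maximum of [c * u - c ^+ 2 / 2] over [c] in [0, 1] is attained at [clamp01 u]. This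
    variational form yields the subgradient inequality with [c] equal to [clamp01 v], and the
    comparison with the positive part with [c] equal to 0 or 1. *)
Lemma smooth_pos_ge u c : 0 <= c <= 1 -> c * u - c ^+ 2 / 2 <= smooth_pos u.
Proof.
move=> /andP[c0 c1]; rewrite /smooth_pos /clamp01.
have := sqr_ge0 (u - c); have := sqr_ge0 (1 - c); have := sqr_ge0 c.
have [u1|u1] := leP u 1.
  by have [u0|u0] := leP 0 u; rewrite !expr2 => *; nra.
by rewrite (max_idPr ler01) !expr2 => *; nra.
Qed.

Lemma smooth_pos_subgradient u v :
  smooth_pos v + clamp01 v * (u - v) <= smooth_pos u.
Proof.
have := @smooth_pos_ge u (clamp01 v).
by rewrite clamp01_ge0 clamp01_le1 /smooth_pos => /(_ isT); lra.
Qed.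

Lemma smooth_pos_ge_pos u : Num.max 0 u - 2^-1 <= smooth_pos u.
Proof.
have [u0|u0] := leP 0 u.
- by have := @smooth_pos_ge u 1; rewrite ler01 lexx => /(_ isT); lra.
- by have := @smooth_pos_ge u 0; rewrite ler01 lexx => /(_ isT); lra.
Qed.

Lemma lipschitz_clamp01 u v : `|clamp01 u - clamp01 v| <= `|u - v|.
Proof.
have nd (a b : R) : a <= b -> 0 <= clamp01 b - clamp01 a <= b - a.
  move=> ab; rewrite /clamp01.
  have [a1|a1] := leP a 1; have [b1|b1] := leP b 1;
    rewrite ?(max_idPr (@ler01 R));
    have [a0|a0] := leP 0 a; have [b0|b0] := leP 0 b; try lra.
have [/nd|/ltW/nd] := leP u v; last by move=> /andP[? ?]; rewrite !ger0_norm//; lra.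
by move=> /andP[? ?]; rewrite !(distrC u) !(distrC _ (clamp01 v)) !ger0_norm//; lra.
Qed.

Lemma lipschitz_smooth_pos u v : `|smooth_pos u - smooth_pos v| <= `|u - v|.
Proof.
have := smooth_pos_subgradient u v; have := smooth_pos_subgradient v u.
have := clamp01_ge0 u; have := clamp01_le1 u.
have := clamp01_ge0 v; have := clamp01_le1 v.
rewrite ler_norml; have [uv|uv] := leP u v.
- by rewrite ler0_norm ?subr_le0// => *; apply/andP; split; nra.
- by rewrite gtr0_norm ?subr_gt0// => *; apply/andP; split; nra.
Qed.

Lemma lipschitz_pos u v : `|Num.max 0 u - Num.max 0 v| <= `|u - v|.
Proof.
have nd (a b : R) : a <= b -> 0 <= Num.max 0 b - Num.max 0 a <= b - a.
  by have [a0|a0] := leP 0 a; have [b0|b0] := leP 0 b; lra.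
have [/nd|/ltW/nd] := leP u v; last by move=> /andP[? ?]; rewrite !ger0_norm//; lra.
by move=> /andP[? ?]; rewrite !(distrC u) !(distrC _ (Num.max 0 v)) !ger0_norm//; lra.
Qed.

Lemma lipschitz_continuousR (h : R -> R) :
  (forall u v, `|h u - h v| <= `|u - v|) -> continuous h.
Proof.
move=> hL u; apply/cvgrPdist_lt => e e0.
apply: filterS (nbhsx_ballx u e e0) => v; exact: le_lt_trans (hL u v).
Qed.

Lemma pos_homogeneous t u : 0 <= t -> Num.max 0 (t * u) = t * Num.max 0 u.
Proof. by move=> t0; rewrite maxr_pMr// mulr0. Qed.

End clamp.

(** * Expectations of Lipschitz functions of linear combinations *)

Section linear_combinations.
Context {d : measure_display} {T : measurableType d} {R : realType}.
Variables (P : probability T R) (k : nat) (Y : 'I_k -> T -> R).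
Hypothesis iY : forall i, L1 P (Y i).
Implicit Types (x y : 'rV[R]_k).

Lemma L1_dotv x : L1 P (fun w => dotv x (Y ^~ w)).
Proof. by apply: L1_sum => i; exact: L1Z. Qed.

Lemma Exp_dotv x : Exp P (fun w => dotv x (Y ^~ w)) = dotv x (fun i => Exp P (Y i)).
Proof.
rewrite Exp_sum; last by move=> i; exact: L1Z.
by apply: eq_bigr => i _; rewrite ExpZ.
Qed.

Lemma Exp_normr_dotv x :
  Exp P (fun w => `|dotv x (Y ^~ w)|) <= `|x| * \sum_i Exp P (fun w => `|Y i w|).
Proof.
rewrite -Exp_sum; last by move=> i; exact: L1_norm.
rewrite -ExpZ; last by apply: L1_sum => i; exact: L1_norm.
apply: le_Exp => [||w]; last exact: normr_dotv.
- exact/L1_norm/L1_dotv.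
- by apply/L1Z/L1_sum => i; exact: L1_norm.
Qed.

Lemma L1_lipschitz (phi : R -> R) (X : T -> R) :
  (forall u v, `|phi u - phi v| <= `|u - v|) -> L1 P X -> L1 P (phi \o X).
Proof.
move=> phiL iX; have [mX _] := iX.
apply: (@L1_le _ _ _ _ _ (fun w => `|X w| + `|phi 0|)).
- apply: measurableT_comp => //.
  exact: continuous_measurable_fun (lipschitz_continuousR phiL).
- by apply: L1D; [exact: L1_norm|exact: L1_cst].
- move=> w /=; rewrite -lerBlDr; apply: le_trans (lerB_dist _ _) _.
  by have := phiL (X w) 0; rewrite subr0.
Qed.

Lemma lipschitz_Exp_comp (phi : R -> R) (X X' : T -> R) :
  (forall u v, `|phi u - phi v| <= `|u - v|) -> L1 P X -> L1 P X' ->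
  `|Exp P (phi \o X) - Exp P (phi \o X')| <= Exp P (fun w => `|X w - X' w|).
Proof.
move=> phiL iX iX'; have iN : L1 P (fun w => `|X w - X' w|) by exact/L1_norm/L1B.
have i1 := L1_lipschitz phiL iX; have i2 := L1_lipschitz phiL iX'.
rewrite ler_norml -ExpB// lerNl -ExpN; last exact: L1B.
apply/andP; split; apply: le_Exp => //.
- exact/L1N/L1B.
- move=> w; have := phiL (X w) (X' w); rewrite ler_norml => /andP[+ _] /=; lra.
- exact: L1B.
- move=> w; have := phiL (X w) (X' w); rewrite ler_norml => /andP[_ +] /=; lra.
Qed.

Lemma lipschitz_Exp_dotv (phi : R -> R) x y :
  (forall u v, `|phi u - phi v| <= `|u - v|) ->
  `|Exp P (fun w => phi (dotv x (Y ^~ w))) - Exp P (fun w => phi (dotv y (Y ^~ w)))|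
    <= (\sum_i Exp P (fun w => `|Y i w|)) * `|x - y|.
Proof.
move=> phiL; apply: le_trans (lipschitz_Exp_comp phiL (L1_dotv x) (L1_dotv y)) _.
rewrite mulrC (le_trans _ (Exp_normr_dotv (x - y)))//.
by under eq_fun do rewrite -dotvBl.
Qed.

End linear_combinations.

(** * The finite moment problem for functions with values in [0, 1] *)

Section moment_problem.
Context {d : measure_display} {T : measurableType d} {R : realType}.
Variable P : probability T R.

Lemma measurable_clamp01 (X : T -> R) : measurable_fun setT X ->
  measurable_fun setT (fun w => clamp01 (X w)).
Proof.
move=> mX; apply: measurableT_comp => //.
exact: continuous_measurable_fun (lipschitz_continuousR lipschitz_clamp01).
Qed.

Lemma clamp01_norm (u : R) : `|clamp01 u| <= 1.
Proof. by rewrite ger0_norm ?clamp01_ge0 ?clamp01_le1. Qed.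

Lemma le_Exp_cvg (f_ : nat -> T -> R) (f g : T -> R) (c : R) :
  (forall m, measurable_fun setT (f_ m)) -> measurable_fun setT f ->
  (forall w, f_ ^~ w @ \oo --> f w) -> L1 P g ->
  (forall m w, `|f_ m w| <= g w) -> (forall m, c <= Exp P (f_ m)) -> c <= Exp P f.
Proof.
move=> mf_ mf cf ig fg cle.
have cE := cvg_Exp mf_ mf cf ig fg.
rewrite -(cvg_lim (@Rhausdorff R) cE).
by apply: limr_ge; [apply/cvg_ex; exists (Exp P f)|exact: nearW].
Qed.

Lemma cvg_addr_harmonic (a b : R) : a + m.+1%:R^-1 * b @[m --> \oo] --> a.
Proof.
have := cvgD (cvg_cst a) (cvgM (@cvg_harmonic R) (cvg_cst b)).
by rewrite mul0r addr0; apply.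
Qed.

(** Strictness makes [E smooth_pos (x.Y) - x.p] coercive in [x], so it has a minimiser. Since
    [clamp01] is the derivative of [smooth_pos], the first-order condition there reads
    [E (clamp01 (x.Y) * Y i) = p i], which provides [Z]. *)
Lemma moment_strict (k : nat) (Y : 'I_k -> T -> R) (p : 'I_k -> R) :
  (forall i, L1 P (Y i)) ->
  (forall x, x != 0 -> dotv x p < Exp P (fun w => Num.max 0 (dotv x (Y ^~ w)))) ->
  exists Z : T -> R, [/\ measurable_fun setT Z, (forall w, 0 <= Z w <= 1) &
    forall i, Exp P (fun w => Z w * Y i w) = p i].
Proof.
move=> iY hp.
have cdot phi : (forall u v : R, `|phi u - phi v| <= `|u - v|) ->
    continuous (fun x => Exp P (fun w => phi (dotv x (Y ^~ w))) - dotv x p).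
  move=> phiL.
  apply: (@lipschitz_continuous_rV _ _ _
    (\sum_i Exp P (fun w => `|Y i w|) + \sum_i `|p i|)) => x y.
  rewrite (_ : _ - _ - _ = Exp P (fun w => phi (dotv x (Y ^~ w))) -
    Exp P (fun w => phi (dotv y (Y ^~ w))) - dotv (x - y) p); last first.
    by rewrite dotvBl; ring.
  rewrite mulrDl; apply: le_trans (ler_normB _ _) _; apply: lerD.
    exact: lipschitz_Exp_dotv.
  by rewrite mulrC normr_dotv.
have [e e0 he] : exists2 e, 0 < e & forall x : 'rV_k, setT x -> e * `|x| <=
    Exp P (fun w => Num.max 0 (dotv x (Y ^~ w))) - dotv x p.
  apply: pos_homogeneous_coercive => //.
  - exact: cdot _ lipschitz_pos.
  - move=> t x t0; rewrite dotvZl mulrBr -ExpZ.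
      by under eq_fun do rewrite dotvZl pos_homogeneous//.
    exact/L1_pos/L1_dotv.
  - by move=> x _ /hp; rewrite subr_gt0.
have ismooth x : L1 P (fun w => smooth_pos (dotv x (Y ^~ w))).
  exact: L1_lipschitz lipschitz_smooth_pos (L1_dotv _ _).
have [x _ xmin] : exists2 x, setT x & forall y : 'rV_k, setT y ->
    Exp P (fun w => smooth_pos (dotv x (Y ^~ w))) - dotv x p <=
    Exp P (fun w => smooth_pos (dotv y (Y ^~ w))) - dotv y p.
  (* Smoothing lowers the positive part by at most 1/2, so the coercivity of the homogeneous
     function survives up to that constant. *)
  apply: (@coercive_min _ _ _ _ e 2^-1) => //.
  - by exists 0.
  - exact: cdot _ lipschitz_smooth_pos.
  move=> x _; have := he x I.
  suff : Exp P (fun w => Num.max 0 (dotv x (Y ^~ w))) - 2^-1 <=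
      Exp P (fun w => smooth_pos (dotv x (Y ^~ w))) by lra.
  rewrite -[X in _ - X](Exp_cst P) -ExpB; last 2 first.
  - exact/L1_pos/L1_dotv.
  - exact: L1_cst.
  apply: le_Exp => // [|w]; last exact: smooth_pos_ge_pos.
  by apply: L1B; [exact/L1_pos/L1_dotv|exact: L1_cst].
pose Z w := clamp01 (dotv x (Y ^~ w)).
have mdot y : measurable_fun setT (fun w => dotv y (Y ^~ w)) by case: (L1_dotv iY y).
(* One-sided first-order condition along [v]. By minimality the difference quotient with step
   [1 / (m + 1)] is at least [v.p]; the subgradient at the perturbed point [u m] bounds it above by
   [E (clamp01 (u m) * v.Y)], and dominated convergence concludes. *)
have hv v : dotv v p <= Exp P (fun w => Z w * dotv v (Y ^~ w)).
  pose u m w := dotv (x + m.+1%:R^-1 *: v) (Y ^~ w).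
  apply: (@le_Exp_cvg (fun m w => clamp01 (u m w) * dotv v (Y ^~ w)) _
    (fun w => `|dotv v (Y ^~ w)|)).
  - by move=> m; exact: (measurable_funM (measurable_clamp01 (mdot _)) (mdot v)).
  - exact: (measurable_funM (measurable_clamp01 (mdot _)) (mdot v)).
  - move=> w; apply: cvgM; last exact: cvg_cst.
    apply: continuous_cvg; first exact: lipschitz_continuousR lipschitz_clamp01 _.
    rewrite /u; under eq_fun do rewrite dotvDl dotvZl.
    exact: cvg_addr_harmonic.
  - exact/L1_norm/L1_dotv.
  - by move=> m w; rewrite normrM ler_piMl// clamp01_norm.
  - move=> m; have t0 : 0 < m.+1%:R^-1 :> R by rewrite invr_gt0.
    have icl : L1 P (fun w => clamp01 (u m w) * dotv v (Y ^~ w)).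
      apply: (@L1_bndM _ _ _ _ 1) => //; last exact: L1_dotv.
      - exact: (measurable_clamp01 (mdot _)).
      - by move=> w; exact: clamp01_norm.
    rewrite -(ler_pM2l t0) -ExpZ//.
    have := xmin (x + m.+1%:R^-1 *: v) I; rewrite dotvDl dotvZl.
    suff : Exp P (fun w => smooth_pos (u m w)) -
        Exp P (fun w => smooth_pos (dotv x (Y ^~ w))) <=
        Exp P (fun w => m.+1%:R^-1 * (clamp01 (u m w) * dotv v (Y ^~ w))).
      by rewrite /u; move: {t0 icl} m.+1%:R^-1 => t; lra.
    rewrite -ExpB//; last exact: ismooth.
    apply: le_Exp => [||w]; [exact: (L1B (ismooth _) (ismooth _))|exact: L1Z|].
    have := smooth_pos_subgradient (dotv x (Y ^~ w)) (u m w).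
    by rewrite {3}/u dotvDl dotvZl; move: (clamp01 _) m.+1%:R^-1 => a t; lra.
exists Z; split.
- exact: (measurable_clamp01 (mdot _)).
- by move=> w; rewrite clamp01_ge0 clamp01_le1.
(* The inequality along both [delta_mx ord0 i] and its opposite gives equality. *)
- move=> i; apply/eqP; rewrite eq_le; apply/andP; split.
    have := hv (- delta_mx ord0 i); rewrite dotvNl dotv_delta.
    under eq_fun do rewrite dotvNl dotv_delta mulrN.
    rewrite ExpN ?lerN2//; apply: (@L1_bndM _ _ _ _ 1) => //.
    - exact: (measurable_clamp01 (mdot _)).
    - by move=> w; exact: clamp01_norm.
  have := hv (delta_mx ord0 i); rewrite dotv_delta.
  by under eq_fun do rewrite dotv_delta.
Qed.

Lemma measurable_indic_fun (b : T -> bool) : measurable_fun setT b ->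
  measurable_fun setT (fun w => (b w)%:R : R).
Proof.
move=> mb; rewrite (_ : (fun _ => _) = fun w => if b w then 1 else 0).
  by apply: measurable_fun_ifT.
by apply/funext => w; case: (b w).
Qed.

(** Right derivative of the positive part at [u] along [v]: the slope is [v] for positive [u], 0 for
    negative [u], and [Num.max 0 v] at the kink. In each case the quotients are eventually
    constant. *)
Lemma cvg_pos_slope (u v : R) :
  (m.+1%:R : R) * (Num.max 0 (u + m.+1%:R^-1 * v) - Num.max 0 u) @[m --> \oo] -->
  (0 < u)%R%:R * v + (u == 0)%R%:R * Num.max 0 v.
Proof.
have t0 m : 0 < m.+1%:R :> R by [].
have cu : u + m.+1%:R^-1 * v @[m --> \oo] --> u by exact: cvg_addr_harmonic.
have [u0|u0|->] := ltgtP u 0.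
- apply: cvg_near_cst; near=> m.
  rewrite max_l ?subrr ?mulr0 ?mul0r ?addr0//.
  by apply: ltW; near: m; exact: (cvgr_lt u cu _ u0).
- apply: cvg_near_cst; near=> m.
  have um : 0 < u + m.+1%:R^-1 * v by near: m; exact: (cvgr_gt u cu _ u0).
  rewrite (max_r (ltW um)) addrC addKr mulVKf ?gt_eqF// mul1r mul0r addr0//.
- apply: cvg_near_cst; near=> m.
  rewrite add0r pos_homogeneous ?invr_ge0// subr0 mulVKf ?gt_eqF//.
  by rewrite mul1r mul0r add0r.
Unshelve. all: by end_near. Qed.

(* One-sided derivative at [x0] of the nonnegative function
   [x |-> E(x.Y)^+ - x.p], which vanishes there. *)
Lemma moment_degenerate (k : nat) (Y : 'I_k -> T -> R) (p : 'I_k -> R) (x0 : 'rV[R]_k) :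
  (forall i, L1 P (Y i)) ->
  (forall x, dotv x p <= Exp P (fun w => Num.max 0 (dotv x (Y ^~ w)))) ->
  dotv x0 p = Exp P (fun w => Num.max 0 (dotv x0 (Y ^~ w))) ->
  let U w := dotv x0 (Y ^~ w) in
  forall x, dotv x (fun i => p i - Exp P (fun w => (0 < U w)%R%:R * Y i w)) <=
    Exp P (fun w => Num.max 0 (dotv x (fun i => (U w == 0)%R%:R * Y i w))).
Proof.
move=> iY hp hx0 U x.
have mU : measurable_fun setT U by case: (L1_dotv iY x0).
have ma : measurable_fun setT (fun w => (0 < U w)%R%:R : R).
  by apply: measurable_indic_fun; exact: measurable_fun_ltr.
have mb : measurable_fun setT (fun w => (U w == 0)%R%:R : R).
  by apply: measurable_indic_fun; exact: measurable_fun_eqr.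
pose V w := dotv x (Y ^~ w).
have iV : L1 P V := L1_dotv iY x.
have [mV _] := iV.
have bnd (b : bool) : `|b%:R| <= 1 :> R by case: b; rewrite ?normr0 ?normr1.
have iaY i : L1 P (fun w => (0 < U w)%R%:R * Y i w).
  by apply: (@L1_bndM _ _ _ _ 1) => //.
have iaV : L1 P (fun w => (0 < U w)%R%:R * V w).
  by apply: (@L1_bndM _ _ _ _ 1) => //.
have ibV : L1 P (fun w => (U w == 0)%R%:R * Num.max 0 (V w)).
  by apply: (@L1_bndM _ _ _ _ 1) => //; exact: L1_pos.
rewrite dotvBr -(Exp_dotv iaY) lerBlDl.
under [in X in _ + Exp _ X]eq_fun do rewrite dotvZr pos_homogeneous ?ler0n//.
under eq_fun do rewrite dotvZr.
rewrite -ExpD//.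
(* The right-hand side is the limit of the difference quotients of [E(x.Y)^+] at [x0] along [x],
   dominated by [V] in absolute value. Each quotient is at least [x.p], by [hp] at the perturbed
   point and equality at [x0]. *)
apply: (@le_Exp_cvg (fun m w => (m.+1%:R : R) *
  (Num.max 0 (U w + m.+1%:R^-1 * V w) - Num.max 0 (U w))) _ (fun w => `|V w|)).
- move=> m; apply: measurable_funM => //; apply: measurable_funB.
    by apply: measurable_maxr => //; apply: measurable_funD => //; exact: measurable_funM.
  exact: measurable_maxr.
- by case: (L1D iaV ibV).
- by move=> w; exact: cvg_pos_slope.
- exact: L1_norm.
- move=> m w; rewrite normrM gtr0_norm// -ler_pdivlMl//.
  apply: le_trans (lipschitz_pos _ _) _.
  by rewrite addrC addKr normrM gtr0_norm ?invr_gt0.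
- move=> m.
  have ipos y : L1 P (fun w => Num.max 0 (dotv y (Y ^~ w))) by exact/L1_pos/L1_dotv.
  have eqU : (fun w => U w + m.+1%:R^-1 * V w) =
      (fun w => dotv (x0 + m.+1%:R^-1 *: x) (Y ^~ w)).
    by apply/funext => w; rewrite dotvDl dotvZl.
  have iposm : L1 P (fun w => Num.max 0 (U w + m.+1%:R^-1 * V w)).
    by apply: L1_pos; rewrite eqU; exact: L1_dotv.
  rewrite ExpZ; last exact: (L1B iposm (ipos x0)).
  rewrite (ExpB iposm (ipos x0)) -hx0 -ler_pdivrMl// lerBrDr.
  have := hp (x0 + m.+1%:R^-1 *: x); rewrite dotvDl dotvZl.
  rewrite -(_ : (fun w => Num.max 0 (U w + m.+1%:R^-1 * V w)) =
    (fun w => Num.max 0 (dotv (x0 + m.+1%:R^-1 *: x) (Y ^~ w)))); first by rewrite addrC.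
  by apply/funext => w; rewrite dotvDl dotvZl.
Qed.

Lemma dotv_lift (k : nat) (j : 'I_k.+1) (x : 'rV[R]_k.+1) (f : 'I_k.+1 -> R) :
  dotv x f = x ord0 j * f j + dotv (\row_i x ord0 (lift j i)) (fun i => f (lift j i)).
Proof.
rewrite /dotv (bigD1_ord j)//=; congr (_ + _).
by apply: eq_bigr => i _; rewrite mxE.
Qed.

(* Induction on the dimension replaces weak-star compactness of the set of
   functions with values in [0, 1]. *)
Lemma moment_exists (k : nat) (Y : 'I_k -> T -> R) (p : 'I_k -> R) :
  (forall i, L1 P (Y i)) ->
  (forall x, dotv x p <= Exp P (fun w => Num.max 0 (dotv x (Y ^~ w)))) ->
  exists Z : T -> R, [/\ measurable_fun setT Z, (forall w, 0 <= Z w <= 1) &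
    forall i, Exp P (fun w => Z w * Y i w) = p i].
Proof.
elim: k Y p => [|k IHk] Y p iY hp.
  (* In dimension 0 every vector is zero, so strictness holds vacuously. *)
  by apply: moment_strict => // x; rewrite (thinmx0 x) eqxx.
have [hs|] := pselect (forall x, x != 0 ->
    dotv x p < Exp P (fun w => Num.max 0 (dotv x (Y ^~ w)))).
  exact: moment_strict.
move=> /existsNP[x0 /not_implyP[x0N0 /negP]]; rewrite -leNgt => hx0.
have {}hx0 : dotv x0 p = Exp P (fun w => Num.max 0 (dotv x0 (Y ^~ w))).
  by apply/eqP; rewrite eq_le hp hx0.
have [j xj0] : exists j, x0 ord0 j != 0 by apply/rV0Pn.
have := moment_degenerate iY hp hx0; rewrite /=.
set U := fun w => dotv x0 (Y ^~ w).
(* Equality along [x0] forces a solution to be 1 where [U] is positive and 0 where it is negative.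
   Only its values on the zero set of [U] remain free, with family [Y'] and target [p']. *)
pose a w : R := (0 < U w)%R%:R; pose b w : R := (U w == 0)%R%:R.
pose Y' i w := b w * Y i w.
pose p' i := p i - Exp P (fun w => a w * Y i w).
move=> hp'.
have mU : measurable_fun setT U by case: (L1_dotv iY x0).
have ma : measurable_fun setT a.
  by apply: measurable_indic_fun; exact: measurable_fun_ltr.
have mb : measurable_fun setT b.
  by apply: measurable_indic_fun; exact: measurable_fun_eqr.
have bnd (c : bool) : `|c%:R| <= 1 :> R by case: c; rewrite ?normr0 ?normr1.
have iaY i : L1 P (fun w => a w * Y i w) by apply: (@L1_bndM _ _ _ _ 1) => // w; exact: bnd.
have iY' i : L1 P (Y' i) by apply: (@L1_bndM _ _ _ _ 1) => // w; exact: bnd.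
have hlift (y : 'rV[R]_k) : dotv y (fun i => p' (lift j i)) <=
    Exp P (fun w => Num.max 0 (dotv y (fun i => Y' (lift j i) w))).
  pose x : 'rV[R]_k.+1 := \row_i (if unlift j i is Some i' then y ord0 i' else 0).
  have dx f : dotv x f = dotv y (fun i => f (lift j i)).
    rewrite (dotv_lift j) mxE unlift_none mul0r add0r; congr dotv.
    by apply/rowP => i; rewrite !mxE liftK.
  have := hp' x; rewrite dx.
  by under [X in _ <= Exp _ X]eq_fun do rewrite dx.
have [Z' [mZ' Z'01 EZ']] := IHk _ _ (fun i => iY' (lift j i)) hlift.
have Z'bnd w : `|Z' w| <= 1 by have /andP[? ?] := Z'01 w; rewrite ger0_norm.
have iZY' i : L1 P (fun w => Z' w * Y' i w) by exact: (@L1_bndM _ _ _ _ 1).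
have EZ'Y i : Exp P (fun w => Z' w * Y' i w) = p' i.
  have [i' ->|->] := unliftP j i; first exact: EZ'.
  (* The dropped moment is recovered: [x0.Y'] is identically 0, and [x0.p'] is 0 because [U^+]
     equals [a * U]. All other terms of the sum vanish, leaving that of index [j] with nonzero
     coefficient. *)
  have : dotv x0 (fun i => Exp P (fun w => Z' w * Y' i w) - p' i) = 0.
    rewrite dotvBr -Exp_dotv// dotvBr -Exp_dotv// hx0.
    rewrite (_ : (fun w => dotv x0 (fun i => Z' w * Y' i w)) = fun=> 0); last first.
      apply/funext => w; rewrite dotvZr dotvZr /b.
      by rewrite -/(U w); have [->|_] := eqVneq (U w) 0; rewrite !(mul0r, mulr0).
    rewrite Exp_cst (_ : (fun w => Num.max 0 _) =
        fun w => dotv x0 (fun i => a w * Y i w)) ?subrr ?subr0//.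
    apply/funext => w; rewrite dotvZr -/(U w) /a.
    by have [_|_] := ltP 0 (U w); rewrite ?mul1r ?mul0r.
  rewrite (dotv_lift j) [X in _ + X]big1 => [|i' _]; last by rewrite EZ' subrr mulr0.
  by rewrite addr0 => /eqP; rewrite mulf_eq0 (negbTE xj0) subr_eq0 => /eqP.
exists (fun w => a w + b w * Z' w); split.
- by apply: measurable_funD => //; exact: measurable_funM.
- move=> w; rewrite /a /b; have [_|_|_] := ltgtP (U w) 0;
    by rewrite ?mul0r ?mul1r ?add0r ?addr0 ?lexx ?ler01.
- move=> i; rewrite (_ : (fun _ => _) = fun w => a w * Y i w + Z' w * Y' i w).
    by rewrite ExpD// EZ'Y /p' addrC subrK.
  by apply/funext => w; rewrite mulrDl /Y' [b w * Z' w]mulrC mulrA.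
Qed.

End moment_problem.

(** * Tail formula and quantiles *)

Lemma ge0_integral_tail d (T : measurableType d) (R : realType)
    (P : probability T R) (Y : T -> R) :
  measurable_fun setT Y -> (forall w, 0 <= Y w) ->
  (\int[P]_w (Y w)%:E = \int[lebesgue_measure]_(s in `[0%R, +oo[) P [set w | (s < Y w)%R])%E.
Proof.
move=> mY Y0; pose Y' : {RV P >-> R} := mfun_Sub (mem_set mY).
have := @ge0_expectation_ccdf _ _ _ P Y' Y0; rewrite expectation_def => ->.
apply: eq_integral => s _; congr (P _).
by apply/seteqP; split => w /=; rewrite in_itv/= andbT.
Qed.

Section quantiles.
Context {d : measure_display} {T : measurableType d} {R : realType}.
Variables (P : probability T R) (X : T -> R).
Hypothesis iX : L1 P X.
Implicit Types m u : R.

Let mX : measurable_fun setT X. Proof. by case: iX. Qed.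

(** Written as the expectation of an indicator, so that monotonicity and convergence of expectations
    apply directly. *)
Definition losstail m : R := Exp P (fun w => (m + X w < 0)%R%:R).

Lemma measurable_losstail m : measurable_fun setT (fun w => (m + X w < 0)%R%:R : R).
Proof.
by apply: measurable_indic_fun; apply: measurable_fun_ltr => //; exact: measurable_funD.
Qed.

Lemma L1_losstail m : L1 P (fun w => (m + X w < 0)%R%:R).
Proof.
apply: (@L1_bnd _ _ _ _ 1); first exact: measurable_losstail.
by move=> w; case: (_ < _); rewrite ?normr0 ?normr1.
Qed.

Lemma losstailE m : P [set w | m + X w < 0] = (losstail m)%:E.
Proof.
rewrite -integral_Exp; last exact: L1_losstail.
set A := [set w | _].
have mA : measurable A.
  rewrite /A (_ : [set w | _] = setT `&` (fun w => m + X w < 0) @^-1` [set true]).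
    by apply: measurable_fun_ltr => //; exact: measurable_funD.
  by rewrite setTI.
rewrite (eq_integral (fun w => (\1_A w)%:E)) => [|w _].
  by rewrite integral_indic ?setIT.
by rewrite indicE mem_setE.
Qed.

Lemma losstail_ge0 m : 0 <= losstail m.
Proof. exact: Exp_ge0. Qed.

Lemma le_losstail m m' : m <= m' -> losstail m' <= losstail m.
Proof.
move=> mm'; apply: le_Exp => [||w]; [exact: L1_losstail..|].
rewrite ler_nat; have [mX0|//] := ltP (m' + X w) 0.
by rewrite (_ : m + X w < 0)// (le_lt_trans _ mX0)// lerD2r.
Qed.

(** Markov's inequality; with its mirror image below it shows that the levels [m] with
    [losstail m <= u] exist and are bounded below, for [u] strictly between 0 and 1. *)
Lemma losstail_markov m : 0 <= m -> m * losstail m <= Exp P (fun w => `|X w|).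
Proof.
move=> m0; rewrite -ExpZ; last exact: L1_losstail.
apply: le_Exp => [||w]; [exact/L1Z/L1_losstail|exact: L1_norm|].
have [mX0|_] := ltP (m + X w) 0; last by rewrite mulr0.
rewrite mulr1 ltr0_norm; lra.
Qed.

Lemma losstail_markovN m : 0 <= m -> m * (1 - losstail (- m)) <= Exp P (fun w => `|X w|).
Proof.
move=> m0; rewrite -[X in X - _](Exp_cst P) -ExpB; [|exact: L1_cst|exact: L1_losstail].
rewrite -ExpZ; last by apply: L1B; [exact: L1_cst|exact: L1_losstail].
apply: le_Exp => [||w].
- by apply/L1Z/L1B; [exact: L1_cst|exact: L1_losstail].
- exact: L1_norm.
- have [_|mX0] := ltP (- m + X w) 0; first by rewrite subrr mulr0.
  rewrite subr0 mulr1 ger0_norm; lra.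
Qed.

(** The inequality [m + X w < 0] is strict, hence stable under small increases of [m]: the
    indicators converge pointwise, and dominated convergence applies. *)
Lemma losstail_right_continuous m u :
  (forall k, losstail (m + k.+1%:R^-1) <= u) -> losstail m <= u.
Proof.
move=> hk.
have cE : losstail (m + k.+1%:R^-1) @[k --> \oo] --> losstail m.
  apply: (cvg_Exp (fun k => measurable_losstail _) (measurable_losstail m) _ (L1_cst P 1)).
  - move=> w; have [mX0|mX0] := ltP (m + X w) 0; last first.
      apply: cvg_near_cst; apply: nearW => k.
      by rewrite ltNge (le_trans mX0)// lerD2r lerDl invr_ge0.
    have cm : (m + X w) + k.+1%:R^-1 * 1 @[k --> \oo] --> m + X w.
      exact: cvg_addr_harmonic.
    apply: cvg_near_cst; apply: filterS (cvgr_lt _ cm _ mX0) => k.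
    by rewrite mulr1 addrAC => ->.
  - by move=> k w; case: (_ < _); rewrite ?normr0 ?normr1.
rewrite -(cvg_lim (@Rhausdorff R) cE).
by apply: limr_le; [apply/cvg_ex; exists (losstail m)|exact: nearW].
Qed.

(** The levels [m] with [losstail m <= u] form a closed half-line: Markov bounds make it nonempty
    and bounded below, right continuity puts the infimum in it, monotonicity does the rest. The
    Galois form replaces the infimum in all later uses. *)
Lemma VaR_quantile u : 0 < u < 1 ->
  exists2 v, VaR P u X = v%:E & forall m, (losstail m <= u) = (v <= m).
Proof.
move=> /andP[u0 u1].
pose S := [set m | losstail m <= u].
have E0 : 0 <= Exp P (fun w => `|X w|) by exact: Exp_ge0.
have S0 : S !=set0.
  exists (Exp P (fun w => `|X w|) / u + 1); rewrite /S /=.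
  set m := _ + 1; have m0 : 0 < m by rewrite ltr_wpDl// divr_ge0// ltW.
  rewrite -(ler_pM2l m0); apply: le_trans (losstail_markov (ltW m0)) _.
  by rewrite /m mulrDl divfK ?gt_eqF// mul1r lerDl ltW.
have lbS : has_lbound S.
  exists (- (Exp P (fun w => `|X w|) / (1 - u))) => m Sm.
  have [m0|m0] := leP 0 m.
    by rewrite (le_trans _ m0)// oppr_le0 divr_ge0// subr_ge0 ltW.
  rewrite lerNl ler_pdivlMr ?subr_gt0//.
  have Nm0 : 0 <= - m by rewrite oppr_ge0 ltW.
  apply: le_trans (losstail_markovN Nm0).
  by rewrite opprK ler_wpM2l// lerD2l lerN2.
have Sv : S (inf S).
  apply: losstail_right_continuous => k.
  have k0 : 0 < k.+1%:R^-1 :> R by rewrite invr_gt0.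
  have [m Sm mk] := inf_adherent k0 (conj S0 lbS).
  exact: le_trans (le_losstail (ltW mk)) Sm.
exists (inf S).
  rewrite /VaR -ereal_inf_EFin//; congr (ereal_inf (EFin @` _)).
  by apply/seteqP; split => m /=; rewrite losstailE lee_fin.
move=> m; apply/idP/idP => [Sm|/le_losstail vm]; first exact: ge_inf.
exact: le_trans vm Sv.
Qed.

End quantiles.

(** * The quantile integral and the Rockafellar-Uryasev function *)

Section expected_shortfall.
Context {d : measure_display} {T : measurableType d} {R : realType}.
Variable P : probability T R.
Implicit Types (X : T -> R) (m u : R).

Definition RU (alpha : R) X m : R :=
  m + alpha^-1 * Exp P (fun w => Num.max 0 (- m - X w)).

Lemma uniform_prob_itv (c : R) : 0 <= c <= 1 ->
  uniform_prob (@ltr01 R) `]0, c[%classic = c%:E.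
Proof.
move=> /andP[c0 c1]; rewrite /uniform_prob.
rewrite (eq_integral (cst 1%:E)) => [|x].
  rewrite integral_cst//= mul1e lebesgue_measure_itv/= lte_fin.
  by rewrite sube0; case: ltgtP c0 => // <-.
rewrite inE/= in_itv/= => /andP[x0 xc].
by rewrite /uniform_pdf (ltW x0) (le_trans (ltW xc) c1) subr0 invr1.
Qed.

(* Layer-cake formula on both sides: under the uniform law, the excess on
   ]0, alpha[ of the quantile function over its value [m] at [alpha] has the
   law of the positive part of [- m - X]. *)
Lemma integral_VaR (alpha : R) X : 0 < alpha < 1 -> L1 P X ->
  exists2 m, VaR P alpha X = m%:E &
  (\int[lebesgue_measure]_(u in [set` `]0%R, alpha[%R]) VaR P u X =
   (alpha * m + Exp P (fun w => Num.max 0 (- m - X w)))%:E)%E.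
Proof.
move=> a01 iX; have /andP[a0 a1] := a01.
pose F := losstail P X.
pose v u := fine (VaR P u X).
have vE u : 0 < u < 1 -> VaR P u X = (v u)%:E.
  by move=> /(VaR_quantile iX)[q qE _]; rewrite /v qE.
have vP u m : 0 < u < 1 -> (F m <= u) = (v u <= m).
  by move=> /(VaR_quantile iX)[q qE qP]; rewrite /v qE qP.
have lt1 u : 0 < u < alpha -> 0 < u < 1.
  by move=> /andP[-> ua]; exact: lt_trans ua a1.
pose m0 := v alpha.
have Fm0 : F m0 <= alpha by rewrite vP.
pose D : set R := [set` `]0, alpha[].
have mD : measurable D by exact: measurable_itv.
pose g u := if 0 < u < alpha then v u - m0 else 0.
have g0 u : 0 <= g u.
  rewrite /g; case: ifPn => // /[dup] /lt1 u1 /andP[_ ua].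
  rewrite subr_ge0 -(vP _ _ a01); apply: le_trans (ltW ua).
  by rewrite (vP _ _ u1).
(* By the Galois property [v u] exceeds [m0 + s] exactly when [u < F (m0 + s)]; the bound
   [u < alpha] is then automatic, since [F (m0 + s) <= F m0 <= alpha]. *)
have glevel s : 0 <= s -> [set u | s < g u] = `]0, F (m0 + s)[%classic.
  move=> s0; apply/seteqP; split => u /=; rewrite in_itv/= /g.
    case: ifPn => [/[dup] /lt1 u1 /andP[u0 ua]|_]; last by rewrite ltNge s0.
    by rewrite ltrBrDl ltNge -vP// -ltNge u0.
  move=> /andP[u0 uF].
  have ua : u < alpha.
    by apply: lt_le_trans uF _; apply: le_trans (le_losstail iX _) Fm0; rewrite lerDl.
  have u1 := lt1 u (introT andP (conj u0 ua)).
  by rewrite u0 ua/= ltrBrDl ltNge -vP// -ltNge.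
have mg : measurable_fun setT g.
  move=> _; apply: (measurability _ (RGenOInfty.measurableE R)) => //.
  move=> _ [_ [s ->] <-]; rewrite setTI.
  have [s0|s0] := leP 0 s.
    rewrite (_ : _ @^-1` _ = `]0, F (m0 + s)[%classic)// -glevel//.
    by apply/seteqP; split => u /=; rewrite in_itv/= andbT.
  rewrite (_ : _ @^-1` _ = setT)//.
  apply/seteqP; split => u //= _; rewrite in_itv/= andbT.
  exact: lt_le_trans s0 (g0 u).
have Ig : (\int[lebesgue_measure]_(u in D) (g u)%:E =
    (Exp P (fun w => Num.max 0 (- m0 - X w)))%:E)%E.
  (* As [g] vanishes off ]0, alpha[, the integral is one against the uniform law on [0, 1], to which
     the tail formula for probability measures applies. *)
  transitivity (\int[uniform_prob (@ltr01 R)]_u (g u)%:E)%E.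
    rewrite integral_uniform//; last exact/measurable_EFinP.
    rewrite subr0 invr1 mul1e integral_mkcond [RHS]integral_mkcond.
    apply: eq_integral => u _; rewrite !patchE.
    have [|] := boolP (u \in D).
      rewrite inE /D/= in_itv/= => /andP[u0 ua].
      by rewrite mem_set//= in_itv/= (ltW u0) (ltW (lt_trans ua a1)).
    rewrite notin_setE /D/= in_itv/= => /negP uD.
    by case: ifP => // _; rewrite /g (negbTE uD).
  rewrite ge0_integral_tail// -integral_Exp; last first.
    by apply: L1_pos; apply: L1B => //; exact: L1_cst.
  have iV : L1 P (fun w => - m0 - X w) by apply: L1B => //; exact: L1_cst.
  rewrite ge0_integral_tail//; first last.
  - by move=> w; rewrite le_max lexx.
  - by case: (L1_pos iV).
  apply: eq_integral => s; rewrite inE/= in_itv/= andbT => s0.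
  rewrite glevel// uniform_prob_itv; last first.
    by rewrite losstail_ge0/= (le_trans _ (ltW a1))// (le_trans _ Fm0)// le_losstail// lerDl.
  rewrite /F -losstailE//; congr (P _).
  apply/seteqP; split => w /=; rewrite lt_max ltNge s0/=; lra.
exists m0; first by rewrite vE.
have intg : lebesgue_measure.-integrable D (EFin \o g).
  apply/integrableP; split; first exact/measurable_funTS/measurable_EFinP.
  under eq_integral => u _ do rewrite /= ger0_norm//.
  by rewrite Ig ltry.
have intc : lebesgue_measure.-integrable D (EFin \o cst m0).
  apply/integrableP; split; first exact/measurable_EFinP.
  rewrite (eq_integral (cst (`|m0|)%:E))// integral_cst//= lebesgue_measure_itv/=.
  by case: ifP => _; rewrite -?EFinB -?EFinM ?mule0 ltry.
transitivity (\int[lebesgue_measure]_(u in D) ((g u)%:E + (cst m0 u)%:E))%E.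
  apply: eq_integral => u; rewrite inE/= in_itv/= => u01.
  by rewrite /g u01 -EFinD subrK vE//; exact: lt1.
have -> := @integralD_EFin _ (measurableTypeR R) R lebesgue_measure D mD
  g (cst m0) intg intc.
rewrite [X in (X + _)%E = _]Ig.
rewrite [X in (_ + X)%E](_ : _ = \int[lebesgue_measure]_(u in D) cst m0%:E u)%E//.
rewrite integral_cst//= lebesgue_measure_itv/= lte_fin a0 sube0.
by rewrite -EFinM -EFinD addrC mulrC.
Qed.

End expected_shortfall.

(** * Minimum formula, duality, sublinearity and continuity of expected shortfall *)

Section coherence.
Context {d : measure_display} {T : measurableType d} {R : realType}.
Variables (P : probability T R) (alpha : R).
Hypothesis a01 : 0 < alpha < 1.
Implicit Types (X Y Z : T -> R) (m u : R).

Let a0 : 0 < alpha. Proof. by case/andP: a01. Qed.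
Let a1 : alpha < 1. Proof. by case/andP: a01. Qed.
Let ia0 : 0 < alpha^-1. Proof. by rewrite invr_gt0. Qed.

Local Notation RU := (RU P alpha).

Lemma L1_loss X m : L1 P X -> L1 P (fun w => - m - X w).
Proof. by move=> iX; apply: L1B => //; exact: L1_cst. Qed.

Lemma L1_shortfall X m : L1 P X -> L1 P (fun w => Num.max 0 (- m - X w)).
Proof. by move=> iX; exact/L1_pos/L1_loss. Qed.

(** The minimiser is the [alpha]-quantile [m]: the slope [1 - losstail / alpha] of the
    Rockafellar-Uryasev function is nonnegative from [m] on and negative before it. *)
Lemma ES_RU X : L1 P X ->
  exists2 m, ES P alpha X = (RU X m)%:E & forall m', RU X m <= RU X m'.
Proof.
move=> iX; have [m VaRm Im] := integral_VaR a01 iX.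
exists m.
  by rewrite /ES Im -EFinM mulrDr mulKf// gt_eqF.
have [v vE vP] := VaR_quantile iX a01.
have {v vE vP} Fm m' : (losstail P X m' <= alpha) = (m <= m').
  by rewrite vP; move: vE; rewrite VaRm => -[->].
have iS := L1_shortfall _ iX; have iT := L1_losstail iX.
move=> m'; rewrite /RU; have [mm'|m'm] := leP m m'.
  have : Exp P (fun w => Num.max 0 (- m - X w)) <=
      Exp P (fun w => Num.max 0 (- m' - X w)) + (m' - m) * losstail P X m.
    rewrite -ExpZ// -ExpD//; last exact: L1Z.
    apply: le_Exp => [||w] //; first by apply: L1D => //; exact: L1Z.
    have [X0|X0] := ltP (m + X w) 0.
      by rewrite mulr1; have [] := leP 0 (- m - X w); have [] := leP 0 (- m' - X w); lra.
    by rewrite mulr0 addr0; have [] := leP 0 (- m - X w); have [] := leP 0 (- m' - X w); lra.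
  have : (m' - m) * losstail P X m <= (m' - m) * alpha.
    by rewrite ler_wpM2l ?subr_ge0// Fm.
  move=> h1 h2.
  have : alpha^-1 * Exp P (fun w => Num.max 0 (- m - X w)) <=
      alpha^-1 * (Exp P (fun w => Num.max 0 (- m' - X w)) + (m' - m) * alpha).
    by rewrite ler_pM2l//; lra.
  rewrite mulrDr [_ * ((m' - m) * _)]mulrCA mulVf ?gt_eqF// mulr1; lra.
(* To the left, [losstail] is known to exceed [alpha] only strictly below [m]. The comparison
   therefore uses the indicator at [m2], within [e] of [m] but not below [m'], and loses at most
   [e]. *)
apply/ler_addgt0Pr => e e0.
pose m2 := Num.max (m - e) m'.
have m2m : m2 < m by rewrite gt_max m'm andbT; lra.
have m'm2 : m' <= m2 by rewrite le_max lexx orbT.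
have m2e : m - e <= m2 by rewrite le_max lexx.
have : Exp P (fun w => Num.max 0 (- m - X w)) + (m2 - m') * losstail P X m2 <=
    Exp P (fun w => Num.max 0 (- m' - X w)).
  rewrite -ExpZ// -ExpD//; last exact: L1Z.
  apply: le_Exp => [||w] //; first by apply: L1D => //; exact: L1Z.
  have [X0|X0] := ltP (m2 + X w) 0.
    by rewrite mulr1; have [] := leP 0 (- m - X w); have [] := leP 0 (- m' - X w); lra.
  by rewrite mulr0 addr0; have [] := leP 0 (- m - X w); have [] := leP 0 (- m' - X w); lra.
have : (m2 - m') * alpha <= (m2 - m') * losstail P X m2.
  by rewrite ler_wpM2l ?subr_ge0// ltW// ltNge Fm -ltNge.
move=> h1 h2.
have : alpha^-1 * (Exp P (fun w => Num.max 0 (- m - X w)) + (m2 - m') * alpha) <=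
    alpha^-1 * Exp P (fun w => Num.max 0 (- m' - X w)).
  by rewrite ler_pM2l//; lra.
rewrite mulrDr [_ * ((m2 - m') * _)]mulrCA mulVf ?gt_eqF// mulr1; lra.
Qed.

Definition rES X : R := fine (ES P alpha X).

Lemma ES_fin X : L1 P X -> ES P alpha X = (rES X)%:E.
Proof. by move=> /ES_RU[m mE _]; rewrite /rES mE. Qed.

Lemma rES_le_RU X m : L1 P X -> rES X <= RU X m.
Proof. by move=> /ES_RU[m' mE]; rewrite /rES mE; apply. Qed.

Lemma rES_RU X : L1 P X -> exists m, rES X = RU X m.
Proof. by move=> /ES_RU[m mE _]; exists m; rewrite /rES mE. Qed.

Lemma Exp_ge0_ae X : L1 P X -> {ae P, forall w, 0 <= X w} -> 0 <= Exp P X.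
Proof.
move=> iX X0; have [mX _] := iX; have [mX' _] := L1_pos iX.
rewrite (@ae_eq_Exp _ _ _ P X (fun w => Num.max 0 (X w)))//.
  by apply: Exp_ge0 => w; rewrite le_max lexx.
by apply: filterS X0 => w w0; rewrite (max_idPr w0).
Qed.

(** As [E Z = 1], the gap between the primal value [RU X m] and the dual value [- E(Z X)] is the
    expectation of a single integrand [q], which is nonnegative wherever [Z] lies between 0 and
    [1 / alpha]. *)
Lemma RU_dual X Z m : L1 P X -> L1 P Z -> L1 P (fun w => Z w * X w) -> Exp P Z = 1 ->
  let q w := alpha^-1 * Num.max 0 (- m - X w) - Z w * (- m - X w) in
  L1 P q /\ RU X m + Exp P (fun w => Z w * X w) = Exp P q.
Proof.
move=> iX iZ iZX EZ q.
have iS := L1_shortfall m iX.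
have -> : q = fun w => alpha^-1 * Num.max 0 (- m - X w) + (m * Z w + Z w * X w).
  by apply/funext => w; rewrite /q; ring.
have iZZ : L1 P (fun w => m * Z w + Z w * X w) by apply: L1D => //; exact: L1Z.
split; first by apply: L1D => //; exact: L1Z.
rewrite ExpD//; last exact: L1Z.
rewrite ExpZ// ExpD//; last exact: L1Z.
by rewrite ExpZ// EZ /RU; ring.
Qed.

Lemma rES_ge_dual X Z : L1 P X -> L1 P Z -> L1 P (fun w => Z w * X w) -> Exp P Z = 1 ->
  {ae P, forall w, 0 <= Z w} -> {ae P, forall w, Z w <= alpha^-1} ->
  - Exp P (fun w => Z w * X w) <= rES X.
Proof.
move=> iX iZ iZX EZ Z0 Z1; have [m ->] := rES_RU iX.
have [iq Eq] := RU_dual m iX iZ iZX EZ.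
rewrite -subr_ge0 opprK Eq; apply: Exp_ge0_ae => //.
apply: filterS2 Z0 Z1 => w Z0 Z1; rewrite subr_ge0.
have [Y0|Y0] := leP 0 (- m - X w); first exact: ler_wpM2r.
by rewrite mulr0 mulr_ge0_le0// ltW.
Qed.

(** A zero gap makes [q] vanish almost surely; under strict bounds on [Z] this happens only where
    [- m - X w] is 0. *)
Lemma rES_eq_dual X Z : L1 P X -> L1 P Z -> L1 P (fun w => Z w * X w) -> Exp P Z = 1 ->
  {ae P, forall w, 0 < Z w} -> {ae P, forall w, Z w < alpha^-1} ->
  rES X = - Exp P (fun w => Z w * X w) -> exists c, {ae P, forall w, X w = c}.
Proof.
move=> iX iZ iZX EZ Z0 Z1; have [m ->] := rES_RU iX => RUE.
have [iq] := RU_dual m iX iZ iZX EZ; rewrite RUE addNr => /esym Eq.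
exists (- m).
have := Exp_eq0_ae iq _ Eq.
case=> [|N [mN PN subN]].
  apply: filterS2 Z0 Z1 => w Z0 Z1; rewrite subr_ge0.
  have [Y0|Y0] := leP 0 (- m - X w); first by rewrite ler_wpM2r// ltW.
  by rewrite mulr0 mulr_ge0_le0// ltW.
have q0 : {ae P, forall w, alpha^-1 * Num.max 0 (- m - X w) - Z w * (- m - X w) = 0}.
  by exists N.
apply: filterS3 Z0 Z1 q0 => w Z0 Z1.
have [Y0|Y0] := leP 0 (- m - X w).
  rewrite -mulrBl => /eqP; rewrite mulf_eq0 subr_eq0 gt_eqF//= subr_eq0 => /eqP ->//.
move=> /eqP; rewrite mulr0 sub0r oppr_eq0 mulf_eq0 (gt_eqF Z0)/= => /eqP Y00.
by move: Y0; rewrite Y00 ltxx.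
Qed.

(** The constant density 1 is admissible in the dual bound because [alpha < 1]; strictness of that
    inequality gives the equality case next. *)
Lemma rES_ge_NExp X : L1 P X -> - Exp P X <= rES X.
Proof.
move=> iX; have E1 : (fun w => cst 1 w * X w) = X by apply/funext => w; rewrite mul1r.
rewrite -[in - _]E1; apply: rES_ge_dual => //.
- exact: L1_cst.
- by rewrite E1.
- exact: Exp_cst.
- by apply: aeW => w; exact: ler01.
- by apply: aeW => w; rewrite invf_ge1// ltW.
Qed.

Lemma rES_eq_NExp X : L1 P X -> rES X = - Exp P X -> exists c, {ae P, forall w, X w = c}.
Proof.
move=> iX; have E1 : (fun w => cst 1 w * X w) = X by apply/funext => w; rewrite mul1r.
rewrite -[in - _]E1; apply: rES_eq_dual => //.
- exact: L1_cst.
- by rewrite E1.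
- exact: Exp_cst.
- by apply: aeW => w; exact: ltr01.
- by apply: aeW => w; rewrite invf_gt1.
Qed.

Lemma le_rESZ t X : 0 < t -> L1 P X -> rES (fun w => t * X w) <= t * rES X.
Proof.
move=> t0 iX; have [m ->] := rES_RU iX.
apply: le_trans (@rES_le_RU _ (t * m) (L1Z t iX)) _.
rewrite /RU mulrDr lerD2l mulrCA -[t * Exp _ _]ExpZ; last exact: L1_shortfall.
rewrite (_ : (fun w => Num.max 0 (- (t * m) - t * X w)) =
  fun w => t * Num.max 0 (- m - X w))//.
by apply/funext => w; rewrite -pos_homogeneous ?ltW// mulrBr mulrN.
Qed.

Lemma rES_cst c : rES (fun=> c) = - c.
Proof.
apply/eqP; rewrite eq_le; apply/andP; split; last first.
  by have := rES_ge_NExp (L1_cst P c); rewrite Exp_cst.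
apply: le_trans (rES_le_RU (- c) (L1_cst P c)) _.
by rewrite /RU opprK subrr maxxx Exp_cst mulr0 addr0.
Qed.

Lemma rESZ t X : 0 <= t -> L1 P X -> rES (fun w => t * X w) = t * rES X.
Proof.
rewrite le_eqVlt => /predU1P[<-|t0] iX.
  by under eq_fun do rewrite mul0r; rewrite rES_cst mul0r oppr0.
apply/eqP; rewrite eq_le le_rESZ//= -ler_pdivlMl//.
apply: le_trans (le_rESZ _ (L1Z t iX)); last by rewrite invr_gt0.
rewrite (_ : (fun w => t^-1 * (t * X w)) = X)//.
by apply/funext => w; rewrite mulKf// gt_eqF.
Qed.

(** The sum of the two minimisers is a candidate for [X + Y], and the positive part is
    subadditive. *)
Lemma rESD X Y : L1 P X -> L1 P Y -> rES (fun w => X w + Y w) <= rES X + rES Y.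
Proof.
move=> iX iY; have [m ->] := rES_RU iX; have [m' ->] := rES_RU iY.
apply: le_trans (rES_le_RU (m + m') (L1D iX iY)) _.
rewrite /RU addrACA -mulrDr lerD2l ler_pM2l// -ExpD; [|exact: L1_shortfall..].
apply: le_Exp => [||w].
- exact/L1_shortfall/L1D.
- by apply: L1D; exact: L1_shortfall.
- by have [] := leP 0 (- (m + m') - _); have [] := leP 0 (- m - X w);
    have [] := leP 0 (- m' - Y w); lra.
Qed.

Lemma lipschitz_rES X Y : L1 P X -> L1 P Y ->
  `|rES X - rES Y| <= alpha^-1 * Exp P (fun w => `|X w - Y w|).
Proof.
have half X' Y' : L1 P X' -> L1 P Y' ->
    rES X' - rES Y' <= alpha^-1 * Exp P (fun w => `|X' w - Y' w|).
  move=> iX iY; have [m ->] := rES_RU iY.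
  rewrite lerBlDr; apply: le_trans (rES_le_RU m iX) _.
  have iN : L1 P (fun w => `|X' w - Y' w|) by exact/L1_norm/L1B.
  rewrite /RU addrCA lerD2l -mulrDr ler_pM2l// -ExpD//; last exact: L1_shortfall.
  apply: le_Exp => [||w]; first exact: L1_shortfall.
    by apply: L1D => //; exact: L1_shortfall.
  have := ler_norm (Y' w - X' w); rewrite distrC; have := normr_ge0 (X' w - Y' w).
  by have [] := leP 0 (- m - X' w); have [] := leP 0 (- m - Y' w); lra.
move=> iX iY; rewrite ler_norml half// andbT lerNl opprB.
apply: le_trans (half _ _ iY iX) _.
by under eq_fun do rewrite distrC.
Qed.

End coherence.

(** * Essentially bounded densities with prescribed moments *)

Section density.
Context {d : measure_display} {T : measurableType d} {R : realType}.
Variable P : probability T R.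

Lemma Linf_normE (Z : T -> R) :
  Linf_norm P Z = ess_sup P (abse \o (EFin \o Z)).
Proof.
rewrite /Linf_norm unlock [X in (0 < X)%E](_ : _ = 1%E) ?lte01//.
exact: probability_setT.
Qed.

Lemma Linf_norm_ae (Z : T -> R) (c : R) : (Linf_norm P Z <= c%:E)%E ->
  {ae P, forall w, Z w <= c}.
Proof.
rewrite Linf_normE => /ess_supP; apply: filterS => w /=.
by rewrite lee_fin; apply: le_trans; exact: ler_norm.
Qed.

Lemma Linf_norm_lt_ae (Z : T -> R) (c : R) : (Linf_norm P Z < c%:E)%E ->
  {ae P, forall w, Z w < c}.
Proof.
rewrite Linf_normE => Zc.
have := ess_sup_ge P (abse \o (EFin \o Z)); apply: filterS => w /=.
move=> /le_lt_trans/(_ Zc); rewrite lte_fin; apply: le_lt_trans; exact: ler_norm.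
Qed.

Lemma Linf_norm_le (Z : T -> R) (c : R) : (forall w, 0 <= Z w <= c) ->
  (Linf_norm P Z <= c%:E)%E.
Proof.
move=> Zc; rewrite Linf_normE; apply/ess_supP; apply: aeW => w /=.
by have /andP[Z0 ?] := Zc w; rewrite lee_fin ger0_norm.
Qed.

(* The moment problem for [(1, Y)] with target [(1, 0)], for the shifted density
   [Z = b + c W] with [W] in [0, 1]. *)
Lemma density_exists (k : nat) (Y : 'I_k -> T -> R) (b c : R) :
  (forall i, L1 P (Y i)) -> 0 < c ->
  (forall m x, (1 - b) * m - b * dotv x (fun i => Exp P (Y i)) <=
     c * Exp P (fun w => Num.max 0 (m + dotv x (Y ^~ w)))) ->
  exists Z : T -> R, [/\ L1 P Z, (forall w, b <= Z w <= b + c), Exp P Z = 1,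
    forall i, L1 P (fun w => Z w * Y i w) & forall i, Exp P (fun w => Z w * Y i w) = 0].
Proof.
move=> iY c0 H.
(* Index [ord0] carries the normalisation [E Z = 1], the lifted indices the conditions
   [E(Z Y j) = 0]; [p] translates both into moments of [W = (Z - b) / c]. *)
pose Y1 (i : 'I_k.+1) : T -> R := oapp Y (cst 1) (unlift ord0 i).
pose p (i : 'I_k.+1) : R :=
  oapp (fun j => - (c^-1 * (b * Exp P (Y j)))) (c^-1 * (1 - b)) (unlift ord0 i).
have iY1 i : L1 P (Y1 i).
  by rewrite /Y1; case: unliftP => [j _|_] //=; exact: L1_cst.
have H1 (x : 'rV[R]_k.+1) :
    dotv x p <= Exp P (fun w => Num.max 0 (dotv x (Y1 ^~ w))).
  pose x' : 'rV[R]_k := \row_i x ord0 (lift ord0 i).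
  have dY w : dotv x (Y1 ^~ w) = x ord0 ord0 + dotv x' (Y ^~ w).
    rewrite (dotv_lift ord0) /Y1 unlift_none/= mulr1; congr (_ + _).
    by congr dotv; apply/funext => i; rewrite liftK.
  have dp : dotv x p = c^-1 * ((1 - b) * x ord0 ord0 - b * dotv x' (fun i => Exp P (Y i))).
    rewrite (dotv_lift ord0) -/x' (_ : (fun i => p (lift ord0 i)) =
      fun i => - (c^-1 * b) * Exp P (Y i)); last first.
      by apply/funext => i; rewrite /p liftK/=; ring.
    by rewrite dotvZr /p unlift_none/=; ring.
  rewrite dp ler_pdivrMl//; apply: le_trans (H _ _) _.
  by under [in leRHS]eq_fun do rewrite dY.
have [W [mW W01 EW]] := moment_exists iY1 H1.
have Wbnd w : `|W w| <= 1 by have /andP[? ?] := W01 w; rewrite ger0_norm.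
have iW : L1 P W by exact: L1_bnd Wbnd.
have iWY i : L1 P (fun w => W w * Y i w) by exact: (@L1_bndM _ _ _ _ 1).
have EW1 : Exp P W = c^-1 * (1 - b).
  have := EW ord0; rewrite /Y1 /p unlift_none/= => <-.
  by under [in RHS]eq_fun do rewrite mulr1.
have EWY i : Exp P (fun w => W w * Y i w) = - (c^-1 * (b * Exp P (Y i))).
  by have := EW (lift ord0 i); rewrite /Y1 /p liftK.
have ZYE i : (fun w => (b + c * W w) * Y i w) = (fun w => b * Y i w + c * (W w * Y i w)).
  by apply/funext => w; ring.
exists (fun w => b + c * W w); split.
- by apply: L1D; [exact: L1_cst|exact: L1Z].
- by move=> w; have /andP[W0 W1] := W01 w; apply/andP; split; nra.
- rewrite ExpD; [|exact: L1_cst|exact: L1Z].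
  by rewrite Exp_cst ExpZ// EW1 mulVKf ?gt_eqF// addrC subrK.
- by move=> i; rewrite ZYE; apply: L1D; exact: L1Z.
- move=> i; rewrite ZYE ExpD; [|exact: L1Z..].
  by rewrite !ExpZ// EWY mulrN mulVKf ?gt_eqF// subrr.
Qed.

End density.

(** * Expected shortfall as a function of the portfolio *)

Section market.
Context {d : measure_display} {T : measurableType d} {R : realType}.
Variables (P : probability T R) (n : nat) (r : R) (S0 : 'I_n -> R).
Variables (S1 : 'I_n -> T -> R) (alpha : R).
Hypothesis market : standing_assumptions P r S0 S1.
Hypothesis a01 : 0 < alpha < 1.
Implicit Types (x y : 'rV[R]_n) (Z : T -> R).

Local Notation Y i w := (Ret S0 S1 i w - r).
Local Notation X := (Xp r S0 S1).
Local Notation f x := (rES P alpha (X x)).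
Let mu i := Exp P (fun w => Y i w).

Let a0 : 0 < alpha. Proof. by case/andP: a01. Qed.
Let a1 : alpha < 1. Proof. by case/andP: a01. Qed.
Let ia0 : 0 < alpha^-1. Proof. by rewrite invr_gt0. Qed.

Lemma L1_excess i : L1 P (fun w => Y i w).
Proof.
by case: market => _ [_ [_ [_ [iR _]]]]; apply: L1B => //; exact: L1_cst.
Qed.

Lemma XpE x : X x = fun w => dotv x (fun i => Y i w).
Proof. by []. Qed.

Lemma L1_Xp x : L1 P (X x).
Proof. exact: (L1_dotv L1_excess). Qed.

Lemma Exp_Xp x : Exp P (X x) = dotv x mu.
Proof. exact: (Exp_dotv L1_excess). Qed.

Lemma XpD x y : X (x + y) = fun w => X x w + X y w.
Proof. by apply/funext => w; exact: dotvDl. Qed.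

Lemma XpZ t x : X (t *: x) = fun w => t * X x w.
Proof. by apply/funext => w; exact: dotvZl. Qed.

Lemma ES_Xp x : ES P alpha (X x) = (f x)%:E.
Proof. exact: (ES_fin a01 (L1_Xp x)). Qed.

Lemma rES_XpD x y : f (x + y) <= f x + f y.
Proof. by rewrite XpD; exact: (rESD a01 (L1_Xp x) (L1_Xp y)). Qed.

Lemma rES_XpZ t x : 0 <= t -> f (t *: x) = t * f x.
Proof. by move=> t0; rewrite XpZ; exact: (rESZ a01 t0 (L1_Xp x)). Qed.

Lemma rES_Xp0 : f 0 = 0.
Proof. by rewrite -[X in f X](scale0r 0) rES_XpZ// mul0r. Qed.

Lemma rES_Xp_ge x : - dotv x mu <= f x.
Proof. by rewrite -Exp_Xp; exact: (rES_ge_NExp a01 (L1_Xp x)). Qed.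

Lemma continuous_rES_Xp : continuous (fun x => f x).
Proof.
apply: (@lipschitz_continuous_rV _ _ _
  (alpha^-1 * \sum_i Exp P (fun w => `|Y i w|))) => x y.
apply: le_trans (lipschitz_rES a01 (L1_Xp x) (L1_Xp y)) _.
rewrite -mulrA ler_pM2l// mulrC.
rewrite (_ : (fun w => `|X x w - X y w|) = fun w => `|dotv (x - y) (fun i => Y i w)|).
  exact: (Exp_normr_dotv L1_excess).
by apply/funext => w; rewrite dotvBl.
Qed.

Lemma Xp_ae_eq0 x : {ae P, forall w, X x w = 0} -> x = 0.
Proof.
case: market => r1 [S0pos [_ [nonred _]]] X0.
(* Wealth [x i] buys [x i / S0 i] shares. Financed by the riskless asset, this position costs
   nothing at time 0 and is worth [X x] at time 1. *)
pose th : 'rV[R]_n := \row_i (x ord0 i / S0 i).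
have S0N0 i : S0 i != 0 by rewrite gt_eqF.
have [||_ th0] := nonred (- \sum_i x ord0 i) th.
- rewrite addrC; apply/eqP; rewrite subr_eq0; apply/eqP.
  by apply: eq_bigr => i _; rewrite mxE divfK.
- apply: filterS X0 => w Xw; rewrite -[RHS]Xw /Xp mulNr mulr_suml -sumrN -big_split.
  by apply: eq_bigr => i _; rewrite mxE /Ret /=; field.
- apply/rowP => i; have /rowP/(_ i) := th0; rewrite !mxE => /eqP.
  by rewrite mulf_eq0 invr_eq0 (negbTE (S0N0 i)) orbF => /eqP.
Qed.

Lemma Xp_ae_cst x c : {ae P, forall w, X x w = c} -> dotv x mu = 0 -> x = 0.
Proof.
move=> Xc x0; apply: Xp_ae_eq0; suff <- : c = 0 by [].
rewrite -x0 -Exp_Xp -(Exp_cst P c); apply: ae_eq_Exp => //.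
- by case: (L1_Xp x).
- by apply: filterS Xc => w ->.
Qed.

(** A nonpositive value would be equality in [f x >= - E X_x = 0], making [X x] constant with mean
    0, and nonredundancy would give [x = 0]. *)
Lemma rES_Xp_gt0 x : dotv x mu = 0 -> x != 0 -> 0 < f x.
Proof.
move=> x0 xN0; rewrite ltNge; apply/negP => fx0; move/eqP: xN0; apply.
have fE : f x = - Exp P (X x).
  apply/eqP; rewrite eq_le (rES_ge_NExp a01 (L1_Xp x)) andbT.
  by rewrite Exp_Xp x0 oppr0.
have [c Xc] := rES_eq_NExp a01 (L1_Xp x) fE.
exact: Xp_ae_cst Xc x0.
Qed.

(** * Existence and geometry of optimal portfolios *)

Lemma Pi_nuE nu : Pi_nu P r S0 S1 nu = [set x | dotv x mu = nu].
Proof. by apply/seteqP; split => x; rewrite /Pi_nu /= Exp_Xp. Qed.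

Lemma Pi_nu_neq0 nu : Pi_nu P r S0 S1 nu !=set0.
Proof.
case: market => _ [_ [_ [_ [iR [i Ri]]]]].
have mui : mu i != 0.
  rewrite /mu ExpB//; last exact: L1_cst.
  by rewrite Exp_cst subr_eq0; apply/eqP.
exists ((nu / mu i) *: delta_mx ord0 i).
by rewrite Pi_nuE /= dotvZl dotv_delta divfK.
Qed.

Lemma continuous_dotv (a : 'I_n -> R) : continuous (fun x : 'rV[R]_n => dotv x a).
Proof.
apply: (@lipschitz_continuous_rV _ _ _ (\sum_i `|a i|)) => x y.
by rewrite -dotvBl mulrC normr_dotv.
Qed.

Lemma closed_Pi_nu nu : closed (Pi_nu P r S0 S1 nu).
Proof.
rewrite Pi_nuE (_ : [set x | _] = (dotv^~ mu) @^-1` [set nu])//.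
by apply: preimage_closed; [move=> x _; exact: continuous_dotv|exact: closed_eq].
Qed.

(** On the subspace of mean 0, positivity and homogeneity give a linear lower bound. The hyperplane
    [Pi_nu] is a translate of it by [x0], and subadditivity transfers the bound up to a constant. *)
Lemma rES_coercive nu : exists e c, 0 < e /\
  forall x, Pi_nu P r S0 S1 nu x -> e * `|x| - c <= f x.
Proof.
have [x0 x0nu] := Pi_nu_neq0 nu.
have [e e0 he] : exists2 e, 0 < e &
    forall x, Pi_nu P r S0 S1 0 x -> e * `|x| <= f x.
  apply: pos_homogeneous_coercive.
  - exact: closed_Pi_nu.
  - by move=> t x _; rewrite Pi_nuE /= dotvZl => ->; rewrite mulr0.
  - exact: continuous_rES_Xp.
  - by move=> t x; exact: rES_XpZ.
  - by move=> x; rewrite Pi_nuE; exact: rES_Xp_gt0.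
exists e, (e * `|x0| + f (- x0)); split=> // x xnu.
have := he (x - x0); rewrite Pi_nuE /= dotvBl.
move: xnu x0nu; rewrite Pi_nuE /= => -> -> /(_ (subrr _)) hx.
have := rES_XpD x (- x0).
have : e * `|x| <= e * (`|x - x0| + `|x0|).
  by rewrite ler_pM2l// -{1}(subrK x0 x) ler_normD.
rewrite mulrDr; move: hx.
by move: (f x) (f (- x0)) (f (x - x0)) => u v w; lra.
Qed.

Lemma Pi_opt_nonempty_compact_convex nu : let A := Pi_opt P r S0 S1 (ES P alpha) nu in
  A !=set0 /\ compact A /\ convex_rV A.
Proof.
have [e [c [e0 hc]]] := rES_coercive nu.
have cPi := closed_Pi_nu (nu := nu).
have [z zPi zmin] := coercive_min (Pi_nu_neq0 nu) cPi continuous_rES_Xp e0 hc.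
have AE : Pi_opt P r S0 S1 (ES P alpha) nu = Pi_nu P r S0 S1 nu `&` [set x | f x <= f z].
  apply/seteqP; split => x.
  - by move=> [xPi [_ /(_ z zPi)]]; rewrite !ES_Xp lee_fin.
  - move=> [xPi /= xz]; split=> //; rewrite ES_Xp ltry; split=> // y yPi.
    by rewrite ES_Xp lee_fin; apply: le_trans xz _; exact: zmin.
rewrite /= AE; split; [by exists z; split => /=|split].
  exact: (coercive_sublevel_compact (v := f z) cPi continuous_rES_Xp e0 hc).
move=> x y t [xPi /= xz] [yPi /= yz] /andP[t0 t1].
have t1' : 0 <= 1 - t by rewrite subr_ge0.
split.
  move: xPi yPi; rewrite Pi_nuE /= dotvDl !dotvZl => -> ->; ring.
rewrite /=; apply: le_trans (rES_XpD _ _) _; rewrite !rES_XpZ//.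
apply: le_trans (lerD (ler_wpM2l t0 xz) (ler_wpM2l t1' yz)) _.
by rewrite -mulrDl addrC subrK mul1r.
Qed.

(** * Arbitrage and bounded martingale densities *)

(** Adding [x] to any portfolio lowers the risk by subadditivity and raises the mean, as
    [E X_x >= - f x > 0]. *)
Lemma strong_arbitrage_neg x : f x < 0 -> strong_rho_arbitrage P r S0 S1 (ES P alpha).
Proof.
move=> fx y; exists (y + x).
have mux : 0 < dotv x mu by rewrite -oppr_lt0 (le_lt_trans (rES_Xp_ge x)).
rewrite !Exp_Xp dotvDl !ES_Xp lte_fin ltrDl; split=> //.
by apply: le_lt_trans (rES_XpD y x) _; rewrite gtrDl.
Qed.

Lemma Exp_ZXp Z x : in_M P r S0 S1 Z ->
  L1 P (fun w => Z w * X x w) /\ Exp P (fun w => Z w * X x w) = 0.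
Proof.
move=> [_ ZY]; have iZY i : L1 P (fun w => Z w * Y i w) by case: (ZY i).
have -> : (fun w => Z w * X x w) = fun w => dotv x (fun i => Z w * Y i w).
  by apply/funext => w; rewrite dotvZr.
split; first exact: (L1_dotv iZY).
rewrite (Exp_dotv iZY) /dotv big1// => i _.
by case: (ZY i) => _ ->; rewrite mulr0.
Qed.

Lemma rES_Xp_ge0 Z x : in_M P r S0 S1 Z -> (Linf_norm P Z <= (alpha^-1)%:E)%E -> 0 <= f x.
Proof.
move=> ZM /Linf_norm_ae Za; have [iZX EZX] := Exp_ZXp x ZM.
case: ZM => -[iZ [Z0 EZ]] _.
by have := rES_ge_dual a01 (L1_Xp x) iZ iZX EZ Z0 Za; rewrite EZX oppr0.
Qed.

(** The minimum formula for [- x] at the level [- m] turns lower bounds on [f] into the hypothesis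
    of [density_exists]. *)
Lemma shortfall_lower_bound m x :
  m + f (- x) <= alpha^-1 * Exp P (fun w => Num.max 0 (m + X x w)).
Proof.
have := rES_le_RU a01 (- m) (L1_Xp (- x)); rewrite /RU opprK.
rewrite (_ : (fun w => Num.max 0 (m - X (- x) w)) = fun w => Num.max 0 (m + X x w)).
  by lra.
by apply/funext => w; rewrite !XpE dotvNl opprK.
Qed.

Lemma no_strong_arbitrage :
  ~ strong_rho_arbitrage P r S0 S1 (ES P alpha) <->
  exists Z, in_M P r S0 S1 Z /\ (Linf_norm P Z <= (alpha^-1)%:E)%E.
Proof.
split=> [noarb|[Z [ZM Za]] /(_ 0)[x [_]]]; last first.
  by rewrite !ES_Xp rES_Xp0 lte_fin ltNge (rES_Xp_ge0 x ZM Za).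
have fge0 x : 0 <= f x by rewrite leNgt; apply/negP => /strong_arbitrage_neg.
(* With [b = 0] and [c = 1 / alpha] the density ranges over [0, 1 / alpha], and nonnegativity of [f]
   is all that is required. *)
have [|Z [iZ Zb EZ iZY EZY]] := density_exists (b := 0) L1_excess ia0.
  move=> m x; rewrite subr0 mul1r mul0r subr0.
  by apply: le_trans (shortfall_lower_bound m x); rewrite lerDl.
exists Z; split; last by apply: Linf_norm_le => w; have := Zb w; rewrite add0r.
split; last by move=> i; split.
by split=> //; split=> //; apply: aeW => w; case/andP: (Zb w).
Qed.

Lemma no_arbitrage :
  ~ rho_arbitrage P r S0 S1 (ES P alpha) <->
  exists Z, in_Pset P r S0 S1 Z /\ (Linf_norm P Z < (alpha^-1)%:E)%E.
Proof.
split=> [/contrapT[pi [Epi noimp]]|[Z [[ZM Z0] Za]] noeff].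
(* A nonzero [x] with [f x <= 0] has positive mean, so [pi + x] would dominate the efficient
   portfolio [pi]. *)
- have fgt0 x : setT x -> x != 0 -> 0 < f x.
    move=> _ xN0; rewrite ltNge; apply/negP => fx; apply: noimp.
    have mux : 0 <= dotv x mu by rewrite -oppr_le0 (le_trans (rES_Xp_ge x)).
    have mux0 : 0 < dotv x mu.
      rewrite lt_neqAle mux andbT; apply/eqP => x0.
      by have := rES_Xp_gt0 (esym x0) xN0; rewrite ltNge fx.
    exists (pi + x); rewrite !Exp_Xp dotvDl !ES_Xp lee_fin lerDl ltrDl.
    split=> //; split; last by left.
    by apply: le_trans (rES_XpD pi x) _; rewrite gerDl.
  have [e e0 he] := pos_homogeneous_coercive closedT (fun _ _ _ _ => I)
    continuous_rES_Xp rES_XpZ fgt0.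
  pose K := \sum_i `|mu i|.
  have K0 : 0 <= K by exact: sumr_ge0.
  (* A positive lower bound [b] on the density costs the mean term [b * x.mu], at most
     [b * K * |x|]; for small [b] it is absorbed by [(1 - b) * e * |x|], the slack from
     coercivity. *)
  have [b b0 [b1 bK]] : exists2 b, 0 < b & b < 1 /\ b * K <= (1 - b) * e.
    have D0 : 0 < K + e + 1 by rewrite addr_gt0// ltr_wpDl.
    have b0 : 0 < e / (K + e + 1) by rewrite divr_gt0.
    have : e / (K + e + 1) * (K + e + 1) = e by rewrite divfK// gt_eqF.
    move: (e / _) b0 => b b0 bD; exists b => //.
    by split; nra.
  have c0 : 0 < (1 - b) * alpha^-1 by rewrite mulr_gt0// subr_gt0.
  have [m x|Z [iZ Zb EZ iZY EZY]] := density_exists (b := b) L1_excess c0.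
    rewrite -mulrA; have b1' : 0 <= 1 - b by rewrite subr_ge0 ltW.
    apply: le_trans (ler_wpM2l b1' (shortfall_lower_bound m x)).
    rewrite mulrDr lerD2l.
    apply: (@le_trans _ _ (b * K * `|x|)).
      rewrite -mulrN -mulrA ler_pM2l// (le_trans (ler_norm _))// normrN mulrC.
      exact: normr_dotv.
    apply: (@le_trans _ _ ((1 - b) * e * `|x|)); first by rewrite ler_wpM2r.
    rewrite -mulrA ler_wpM2l//.
    by have := he (- x) I; rewrite normrN.
  have Zgt0 w : 0 < Z w by case/andP: (Zb w) => /(lt_le_trans b0).
  exists Z; split.
    split; last by apply: aeW.
    split; last by move=> i; split.
    by split=> //; split=> //; apply: aeW => w; exact/ltW.
  (* The upper bound is a convex combination of 1 and [1 / alpha] with weight [b > 0] on 1, hence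
     strictly below [1 / alpha]. *)
  apply: (@le_lt_trans _ _ (b + (1 - b) * alpha^-1)%:E).
    by apply: Linf_norm_le => w; case/andP: (Zb w) => ? ?; rewrite ltW//=.
  rewrite lte_fin; have : 1 < alpha^-1 by rewrite invf_gt1.
  move: (alpha^-1) => a a_gt1; nra.
(* The zero portfolio is efficient. A portfolio [x] dominating it would have [f x = 0], so equality
   in the dual bound makes [X x] a constant [c]; then [c = E(Z X_x) = 0] contradicts its positive
   mean. *)
- apply: noeff; exists 0; split; first by rewrite Exp_Xp dotv0l.
  move=> [x]; rewrite !Exp_Xp dotv0l !ES_Xp rES_Xp0 lee_fin lte_fin => -[mu0 [fx0]].
  have fge0 := rES_Xp_ge0 x ZM (ltW Za).
  case=> [mupos|]; last by rewrite ltNge fge0.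
  have [iZX EZX] := Exp_ZXp x ZM; have [[iZ [_ EZ]] _] := ZM.
  have fE : f x = - Exp P (fun w => Z w * X x w).
    by rewrite EZX oppr0; apply/eqP; rewrite eq_le fx0.
  have [c Xc] := rES_eq_dual a01 (L1_Xp x) iZ iZX EZ Z0 (Linf_norm_lt_ae Za) fE.
  have c0 : c = 0.
    rewrite -EZX -[LHS]mulr1 -EZ -ExpZ//; have [mcZ _] := L1Z c iZ.
    have [mZX _] := iZX; apply: ae_eq_Exp => //.
    by apply: filterS Xc => w ->; rewrite mulrC.
  move: mupos; rewrite -Exp_Xp (_ : Exp P (X x) = 0) ?ltxx//.
  rewrite -(Exp_cst P 0); apply: ae_eq_Exp => //; first by case: (L1_Xp x).
  by apply: filterS Xc => w ->.
Qed.

End market.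

Theorem theorem5p4 (d : measure_display) (T : measurableType d) (R : realType)
  (P : probability T R) (n : nat) (r : R) (S0 : 'I_n -> R) (S1 : 'I_n -> T -> R)
  (alpha : R) :
  standing_assumptions P r S0 S1 ->
  0 < alpha < 1 ->
  (forall nu : R, 0 <= nu ->
     let A := Pi_opt P r S0 S1 (ES P alpha) nu in
     A !=set0 /\ compact A /\ convex_rV A) /\
  (~ strong_rho_arbitrage P r S0 S1 (ES P alpha) <->
     exists Z, in_M P r S0 S1 Z /\ (Linf_norm P Z <= (alpha^-1)%:E)%E) /\
  (~ rho_arbitrage P r S0 S1 (ES P alpha) <->
     exists Z, in_Pset P r S0 S1 Z /\ (Linf_norm P Z < (alpha^-1)%:E)%E).
Proof.
move=> market a01; split.
  by move=> nu _; exact: Pi_opt_nonempty_compact_convex.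
split; [exact: no_strong_arbitrage|exact: no_arbitrage].
Qed.
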